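(* Let $(G_1,v_1),\dots,(G_k,v_k)$ be basic pairs of order $n$ with corresponding integer partitions $p_1,\dots,p_k$ of $n$. For each $i$ let $Z_{p_i}:=\bigcup_{\sigma\in S_n}\sigma\cdot Z_{G_i}$, where $Z_{G_i}$ is the atomic extremal assignment generated by $(G_i,v_i)$. Then $Z:=\bigcup_{i=1}^k Z_{p_i}$ is an ($S_n$-invariant) extremal assignment if and only if $\mathcal{F}=\{p_1,\dots,p_k\}$ is a special family.
   Context: $[n]=\{1,\dots,n\}$. A stable $n$-labeled tree is a finite tree with $n$ leaves labeled bijectively by $[n]$, all internal vertices of degree $\ge 3$; $V(G)$ its internal vertices; $S(n)$ the set of such trees up to label-preserving isomorphism. $G\rightsquigarrow G'$: $G'$ obtained by collapsing connected sets of internal vertices, inducing surjection $\pi:V(G)\to V(G')$. An extremal assignment of order $n$: rule $Z(G)\subset V(G)$ for $G\in S(n)$ with (a) $Z(G)\ne V(G)$, (b) if $G\rightsquigarrow G'$ and $\pi^{-1}(v')=\{v_1,\dots,v_k\}$ then $v'\in Z(G')\iff v_1,\dots,v_k\in Z(G)$. Unions are vertexwise. A basic pair $(G,v)$: $G\in S(n)$ with at least two internal vertices and $v\in V(G)$ adjacent to all other internal vertices; its set partition has as blocks the label sets of the connected components of $G$ minus $v$, and its integer partition is the multiset of block sizes. The atomic extremal assignment generated by $(G,v)$ is the smallest extremal assignment with $v$ assigned. $S_n$ acts on $S(n)$ by relabeling leaves ($\sigma\cdot G$ relabels leaf $i$ as $\sigma(i)$, with $V(\sigma\cdot G)$ identified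 with $V(G)$), and on assignments by $(\sigma\cdot Z)(\sigma\cdot G)=Z(G)$. Integer partitions of $n$: $p\le q$ if $q$ is a refinement of $p$ (the parts of $q$ can be grouped so that the group sums are exactly the parts of $p$). Given a family $\mathcal{F}=\{p_1,\dots,p_k\}$, a one-step replacement of an integer partition $q$ is obtained by removing a sub-multiset $\{\lambda_i\}_{i\in I}$ of parts of $q$ and adding a sub-multiset $\{\mu_j\}_{j\in J}$ of parts of some $p_t\in\mathcal{F}$ with $\sum_{i\in I}\lambda_i=\sum_{j\in J}\mu_j$. A replacement in $\mathcal{F}$ is any partition obtained by finitely many one-step replacements starting from some $q\le p_s$, $p_s\in\mathcal{F}$. $\mathcal{F}$ is a special family if every replacement $r$ in $\mathcal{F}$ satisfies $r\le p_j$ for some $p_j\in\mathcal{F}$. *)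

(* Defs.v *)
From HB Require Import structures.
From mathcomp Require Import all_boot fingroup perm.
Set Implicit Arguments. Unset Strict Implicit. Unset Printing Implicit Defensive.

(* Stable n-labeled trees (concrete representatives).                  *)
(* Internal vertices are 'I_nint; leaf i is attached to internal       *)
(* vertex [att i]; [adj] is the adjacency among internal vertices.     *)
Record tree_data (n : nat) := TreeData {
  nint : nat;
  adj : rel 'I_nint;
  att : 'I_n -> 'I_nint
}.
Arguments TreeData {n}.
Arguments nint {n} t.
Arguments adj {n} t _ _.
Arguments att {n} t _.

Definition is_stable_tree n (G : tree_data n) : Prop :=
  [/\ 0 < nint G,
      symmetric (adj G) /\ irreflexive (adj G),
      (forall u w, connect (adj G) u w),
      #|[set p : 'I_(nint G) * 'I_(nint G) | adj G p.1 p.2]| = 2 * (nint G).-1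
    & forall w, 3 <= #|[set u | adj G w u]| + #|[set i | att G i == w]| ].

(* G ~> G' : G' is obtained (up to label-preserving isomorphism) by    *)
(* collapsing connected sets of internal vertices; pi is the induced   *)
(* surjection V(G) -> V(G').                                            *)
Definition contracts n (G G' : tree_data n) (pi : 'I_(nint G) -> 'I_(nint G')) : Prop :=
  [/\ (forall w', exists w, pi w = w'),
      (forall w1 w2, pi w1 = pi w2 ->
          connect (fun x y => adj G x y && (pi x == pi y)) w1 w2),
      (forall i, att G' i = pi (att G i))
    & (forall u' w', adj G' u' w' =
          (u' != w') && [exists x, exists y, [&& pi x == u', pi y == w' & adj G x y]])].

Arguments contracts {n} G G' pi.

Definition assignment n := forall G : tree_data n, {set 'I_(nint G)}.

Definition extremal n (Z : assignment n) : Prop :=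
  (forall G, is_stable_tree G -> Z G != [set: 'I_(nint G)]) /\
  (forall G G' pi, is_stable_tree G -> is_stable_tree G' -> contracts G G' pi ->
     forall v', (v' \in Z G') = [forall w, (pi w == v') ==> (w \in Z G)]).

Definition is_basic_pair n (G : tree_data n) (v : 'I_(nint G)) : Prop :=
  is_stable_tree G /\ 2 <= nint G /\ (forall w, w != v -> adj G v w).

Definition is_atomic n (G : tree_data n) (v : 'I_(nint G)) (Z : assignment n) : Prop :=
  [/\ extremal Z, v \in Z G &
      forall Z' : assignment n, extremal Z' -> v \in Z' G ->
        forall H, is_stable_tree H -> Z H \subset Z' H].

(* S_n action: sigma . G relabels leaf i as sigma i. *)
Definition relabel n (s : 'S_n) (G : tree_data n) : tree_data n :=
  TreeData (nint G) (adj G) (fun j => att G (s^-1%g j)).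

(* (sigma . Z)(sigma . G) = Z(G), i.e. (sigma . Z)(H) = Z(sigma^-1 . H). *)
Definition act_assign n (s : 'S_n) (Z : assignment n) : assignment n :=
  fun H => Z (relabel s^-1%g H).

Definition full_adj n (G : tree_data n) : rel ('I_n + 'I_(nint G))%type :=
  fun x y => match x, y with
  | inl i, inr w => att G i == w
  | inr w, inl i => att G i == w
  | inr a, inr b => adj G a b
  | _, _ => false
  end.

Arguments full_adj {n} G x y.

Definition adj_minus n (G : tree_data n) (v : 'I_(nint G)) : rel ('I_n + 'I_(nint G))%type :=
  fun x y => [&& x != inr v, y != inr v & full_adj G x y].

Definition block n (G : tree_data n) (v : 'I_(nint G)) (i : 'I_n) : {set 'I_n} :=
  [set j | connect (adj_minus v) (inl i) (inl j)].

Definition set_partition n (G : tree_data n) (v : 'I_(nint G)) : {set {set 'I_n}} :=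
  [set block v i | i : 'I_n].

Definition int_partition n (G : tree_data n) (v : 'I_(nint G)) : seq nat :=
  [seq #|B| | B : {set 'I_n} <- enum (set_partition v)].

(* Integer partitions as multisets (seq nat, up to perm_eq).           *)
Definition positive_parts (p : seq nat) : bool := all (fun x => 0 < x) p.

Definition refines (q p : seq nat) : Prop :=
  exists f : 'I_(size q) -> 'I_(size p),
    forall j : 'I_(size p), \sum_(i < size q | f i == j) nth 0 q i = nth 0 p j.

Definition part_le (p q : seq nat) : Prop :=
  [/\ positive_parts p, positive_parts q & refines q p].

Definition one_step (F : seq (seq nat)) (q r : seq nat) : Prop :=
  exists pt, pt \in F /\
  exists kept removed added rest,
    [/\ perm_eq q (kept ++ removed),
        perm_eq pt (added ++ rest),
        sumn removed = sumn added
      & perm_eq r (kept ++ added)].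

Inductive replacement (F : seq (seq nat)) : seq nat -> Prop :=
| repl_base q ps : ps \in F -> part_le q ps -> replacement F q
| repl_step q r : replacement F q -> one_step F q r -> replacement F r.

Definition special_family (F : seq (seq nat)) : Prop :=
  forall r, replacement F r -> exists2 pj, pj \in F & part_le r pj.

(* Main.v *)
(* An extremal assignment only sees the relation [sep w] on leaves (being joined
   in the tree minus [w]), because collapsing the branches at [w] gives a star
   that depends on [sep w] alone.  The atomic assignment generated by [(G, v)]
   selects exactly the [w] whose [sep w] is coarser than [sep v]; hence [Z]
   selects the [w] whose block sizes form a partition below some [p_i].

   Such a family of vertices always passes from a contraction to its fibres.
   The converse is closure under gluing along an edge: if the edge cuts the
   leaves into [U] and its complement, the block [U] of one vertex is traded for
   the blocks inside [U] of the other, which is a one-step replacement.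
   Conversely, every one-step replacement that adds at least two parts and keeps
   at least two is such a gluing in an explicit tree with two centres; in the remaining cases the result is below a member already known. *)
Require Import Defs.
From HB Require Import structures.
From mathcomp Require Import all_boot fingroup perm.
From mathcomp Require Import zify.
Set Implicit Arguments. Unset Strict Implicit. Unset Printing Implicit Defensive.

(** * Integer partitions and labellings *)

(** Only block sizes are constrained, so in the gluing the member of the family above the second
    vertex is first moved by a permutation until its blocks lie inside those of that vertex; its
    parts inside [U] are then what the replacement adds. Gluing one vertex at a time along a
    connected set yields both axioms. For a fibre of a contraction, the intersection of the
    relations [sep u] is contained in that of the image. Over a whole tree the intersection is
    equality of leaves, so assigning every vertex would put the partition into ones below some
    [p_i]; this is impossible because the second internal vertex of a basic pair forces a part of
    size at least two. In the other direction, two kept and two added parts give each of the two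
    centres degree at least three, counting the edge between them. Rooted trees are handled through
    the leaf sets below their vertices: these form a laminar family, and passing to a subfamily is a
    contraction, which supplies the auxiliary trees and the contractions onto them. *)

Definition ref_by (f : nat -> nat) (q p : seq nat) : Prop :=
  (forall i, i < size q -> f i < size p) /\
  (forall j, j < size p ->
     \sum_(0 <= i < size q | f i == j) nth 0 q i = nth 0 p j).

(** Grouping functions on plain numbers avoid casts between ordinals when part lists are
    concatenated; their values beyond [size q] are irrelevant. *)
Lemma refinesP q p : refines q p <-> exists f, ref_by f q p.
Proof.
split=> [[f Hf]|[f [f_lt Hf]]].
- exists (fun i => oapp (fun i' => val (f i')) 0 (insub i)); split.
    by move=> i ltiq; rewrite insubT /=.
  move=> j ltjp; rewrite -[j]/(val (Ordinal ltjp)) -(Hf (Ordinal ltjp)).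
  rewrite big_mkord; apply: eq_bigl => i.
  by rewrite valK.
- exists (fun i : 'I_(size q) => Ordinal (f_lt i (ltn_ord i))) => j.
  by rewrite -(Hf j (ltn_ord j)) big_mkord; apply: eq_bigl.
Qed.

Lemma refines_trans q p r : refines q p -> refines p r -> refines q r.
Proof.
move=> [f Hf] [g Hg]; exists (g \o f) => k.
rewrite -Hg (partition_big f (fun j => g j == k)) //=.
apply: eq_bigr => j /eqP gj; rewrite -Hf; apply: eq_bigl => i.
by case: (f i =P j) => [->|]; rewrite ?gj ?eqxx ?andbF.
Qed.

Lemma perm_refines q p : perm_eq q p -> refines q p.
Proof.
move=> pqp; apply/refinesP.
have [Is pIs qE] := perm_iotaP 0 pqp.
have szI : size Is = size q by rewrite qE size_map.
exists (nth 0 Is); split=> [i ltiq|j ltjp].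
  have: nth 0 Is i \in Is by apply: mem_nth; rewrite szI.
  by rewrite (perm_mem pIs) mem_iota.
transitivity (\sum_(y <- Is | y == j) nth 0 p y).
  rewrite [RHS](big_nth 0) szI big_nat_cond [RHS]big_nat_cond.
  apply: eq_bigr => i /andP[/andP[_ lti] _].
  by rewrite {1}qE (nth_map 0) // szI.
rewrite (perm_big _ pIs) /= big_mkcond /=.
rewrite (bigD1_seq j) ?iota_uniq ?mem_iota //= eqxx big1 ?addn0 //.
by move=> i /negPf->.
Qed.

Lemma sumn_nth s : \sum_(0 <= i < size s) nth 0 s i = sumn s.
Proof. by rewrite sumnE [RHS](big_nth 0). Qed.

Lemma refines_sumn q p : refines q p -> sumn q = sumn p.
Proof.
move=> [f Hf]; rewrite -!sumn_nth !big_mkord (partition_big f xpredT) //=.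
by apply: eq_bigr => j _; exact: Hf.
Qed.

(** Capping indices at [size k] fixes those of [k] and sends all of [r] to the one new last part. *)
Lemma ref_by_merger k r :
  ref_by (fun i => minn i (size k)) (k ++ r) (k ++ [:: sumn r]).
Proof.
split=> [i _|j]; first by rewrite size_cat /=; lia.
rewrite !size_cat addn1 ltnS => lej.
rewrite (@big_cat_nat _ _ _ (size k)) //=; last by lia.
rewrite [X in _ + X](_ : _ = if j == size k then sumn r else 0); last first.
  rewrite big_nat_cond; case: eqP => [->|/eqP nj]; last first.
    by rewrite big1 // => i /andP[/andP[h1 h2] /eqP h3]; lia.
  rewrite -sumn_nth -{1}[size k]add0n big_addn addKn [RHS]big_nat_cond.
  apply: eq_big => [i|i _]; first by lia.
  by rewrite nth_cat; case: ltnP => h; [lia|congr nth; lia].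
rewrite nth_cat; have [ltj|gej] := ltnP j (size k).
  rewrite [j == _](ltn_eqF ltj) addn0 big_nat_cond (eq_bigl (pred1 j)); last first.
    by move=> i /=; apply/idP/idP => [|/eqP->]; lia.
  rewrite big_mkcond /= (bigD1_seq j) ?iota_uniq ?mem_index_iota //= eqxx.
  by rewrite nth_cat ltj big1 ?addn0 // => i /negPf->.
have -> : j = size k by lia.
rewrite eqxx subnn /= big_nat_cond big1 // => i /andP[/andP[h1 h2] /eqP h3]; lia.
Qed.

(** Truncated subtraction sends every index of [k] to 0, and the successor shifts the indices of [r]
    to make room for the merged part in front. *)
Lemma ref_by_mergel k r :
  ref_by (fun i => i.+1 - size k) (k ++ r) (sumn k :: r).
Proof.
split=> [i|j]; first by rewrite size_cat /=; lia.
rewrite size_cat /= ltnS => lej.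
rewrite (@big_cat_nat _ _ _ (size k)) //=; last by lia.
rewrite [X in X + _](_ : _ = if j == 0 then sumn k else 0); last first.
  rewrite big_nat_cond; case: eqP => [->|/eqP nj]; last first.
    by rewrite big1 // => i /andP[/andP[h1 h2] /eqP h3]; lia.
  rewrite -sumn_nth [RHS]big_nat_cond.
  apply: eq_big => [i|i h]; first by lia.
  by rewrite nth_cat; case: ltnP => h'; lia.
case: j lej => [_|j ltj] /=.
  by rewrite big_nat_cond big1 ?addn0 // => i /andP[/andP[h1 h2] /eqP h3]; lia.
rewrite big_nat_cond add0n (eq_bigl (pred1 (size k + j))); last first.
  by move=> i /=; apply/idP/idP => [|/eqP->]; lia.
rewrite big_mkcond /= (bigD1_seq (size k + j)) ?iota_uniq ?mem_index_iota //=; last by lia.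
rewrite eqxx nth_cat big1 ?addn0 => [|i /negPf->//].
by case: ltnP => h; [lia|congr nth; lia].
Qed.

Lemma positive_parts_cat p q :
  positive_parts (p ++ q) = positive_parts p && positive_parts q.
Proof. exact: all_cat. Qed.

Lemma perm_positive p q : perm_eq p q -> positive_parts p = positive_parts q.
Proof. exact: perm_all. Qed.

Lemma positive_sumn0 p : positive_parts p -> sumn p = 0 -> p = [::].
Proof. by case: p => //= x p /andP[x0 _]; lia. Qed.

Lemma sumn_gt0 p : 0 < size p -> positive_parts p -> 0 < sumn p.
Proof. by case: p => //= x p _ /andP[]; lia. Qed.

Lemma part_le_trans p q r : part_le p q -> part_le q r -> part_le p r.
Proof.
by move=> [pp pq qp] [_ pr rq]; split=> //; apply: refines_trans rq qp.
Qed.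

Lemma part_le_perm p q : positive_parts p -> perm_eq p q -> part_le p q.
Proof.
move=> pp pq; split=> //; first by rewrite -(perm_positive pq).
by apply: perm_refines; rewrite perm_sym.
Qed.

(** A single part is the merger of any list with the same sum; if [x] is empty, positivity makes [y]
    empty too. *)
Lemma part_le_small k x y : positive_parts (k ++ x) -> positive_parts (k ++ y) ->
  sumn x = sumn y -> size x <= 1 -> part_le (k ++ x) (k ++ y).
Proof.
move=> px py sxy; case: x px sxy => [|a [|//]] px sxy _.
  rewrite (@positive_sumn0 y) //; first by apply: part_le_perm.
  by move: py; rewrite positive_parts_cat => /andP[].
split=> //; apply/refinesP; exists (fun i => minn i (size k)).
rewrite (_ : a = sumn y); first exact: ref_by_merger.
by rewrite -sxy /= addn0.
Qed.

(** An ordered set partition of the leaves with block sizes [q], given by the block index of each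
    leaf. *)
Definition lab n (a : 'I_n -> nat) (q : seq nat) : Prop :=
  (forall x, a x < size q) /\
  (forall k, k < size q -> #|[set x | a x == k]| = nth 0 q k).

Lemma lab_ref_by n (a : 'I_n -> nat) f q p :
  lab a q -> ref_by f q p -> lab (f \o a) p.
Proof.
move=> [a_lt aq] [f_lt fq]; split=> [x|j ltj] /=; first exact: f_lt.
rewrite -fq // -sum1_card big_mkord.
rewrite (partition_big (fun x => Ordinal (a_lt x)) (fun i => f i == j)) /=; last first.
  by move=> x; rewrite inE.
apply: eq_bigr => i /eqP fi; rewrite -aq // -sum1_card.
apply: eq_bigl => x; rewrite !inE -val_eqE /=.
by case: (a x =P i) => [->|]; rewrite ?fi ?eqxx ?andbF.
Qed.

(** Since the parts of [q] are positive, every index labels some leaf, and a part of [q] is grouped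
    according to the second label of any such leaf. *)
Lemma lab_refines n (a a' : 'I_n -> nat) q p : positive_parts q ->
  lab a q -> lab a' p -> (forall x y, a x = a y -> a' x = a' y) -> refines q p.
Proof.
move=> pq [a_lt aq] [a'_lt ap] aa'; apply/refinesP.
pose f i := oapp a' 0 [pick x | a x == i].
have fa x : f (a x) = a' x.
  rewrite /f; case: pickP => [y /eqP/aa'//|/(_ x)]; by rewrite eqxx.
exists f; split=> [i lti|j ltj].
  have: 0 < #|[set x | a x == i]| by rewrite aq //; apply: (all_nthP 0 pq).
  by case/card_gt0P => x; rewrite inE => /eqP <-; rewrite fa.
rewrite -ap // -sum1_card big_mkord.
rewrite (partition_big (fun x => Ordinal (a_lt x)) (fun i => f i == j)) /=; last first.
  by move=> x; rewrite inE fa.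
apply: eq_bigr => i /eqP fi; rewrite -aq // -sum1_card.
apply: eq_bigl => x; rewrite !inE -val_eqE /=.
by case: (a x =P i) => [ai|]; rewrite ?andbF // -fa ai fi eqxx.
Qed.

Lemma lab_exists n q : sumn q = n -> exists a : 'I_n -> nat, lab a q.
Proof.
(* [s] repeats each index [k] as often as the part number [k] prescribes; its entries serve as
   labels. *)
move=> sq; pose s := flatten [seq nseq (nth 0 q k) k | k <- iota 0 (size q)].
have cs j : count_mem j s = if j < size q then nth 0 q j else 0.
  rewrite count_flatten -map_comp sumnE big_map.
  under eq_bigr => i _ do rewrite /= count_nseq /=.
  rewrite -/(index_iota 0 (size q)).
  case: ltnP => [ltj|gej].
    rewrite (bigD1_seq j) ?iota_uniq ?mem_iota //= eqxx mul1n big1 ?addn0 //.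
    by move=> i /negPf->.
  rewrite big_seq_cond big1 // => i /andP[]; rewrite mem_iota => lti _.
  by case: eqP => // h; lia.
have szs : size s = n.
  rewrite size_flatten /shape -map_comp sumnE big_map -sq -sumn_nth /index_iota subn0.
  by apply: eq_bigr => i _; rewrite /= size_nseq.
exists (fun x => nth 0 s x); split=> [x|k ltk].
  have: nth 0 s x \in s by rewrite mem_nth ?szs.
  by rewrite -has_pred1 has_count cs; case: ifP.
rewrite -[RHS](_ : count_mem k s = _); last by rewrite cs ltk.
rewrite -sum1_card -sum1_count [RHS](big_nth 0) szs big_mkord.
by apply: eq_bigl => x; rewrite inE.
Qed.

(** Both label tuples contain each index equally often, so one rearranges the other; this is where
    the symmetric group enters. *)
Lemma lab_perm n (a b : 'I_n -> nat) q : lab a q -> lab b q ->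
  exists s : 'S_n, forall x, b x = a (s x).
Proof.
move=> [a_lt aq] [b_lt bq].
have: perm_eq [tuple b i | i < n] [tuple a i | i < n].
  have C (c : 'I_n -> nat) j :
      count_mem j [tuple c i | i < n] = #|[set x | c x == j]|.
    rewrite /= count_map -size_filter cardE; apply: perm_size.
    apply: uniq_perm; rewrite ?filter_uniq -?enumT ?enum_uniq // => x.
    by rewrite mem_filter !mem_enum !inE andbT.
  apply/allP => j _; apply/eqP; rewrite !C.
  have [lt|ge] := ltnP j (size q); first by rewrite aq // bq.
  have Z (c : 'I_n -> nat) : (forall x, c x < size q) -> #|[set x | c x == j]| = 0.
    move=> H; apply/eqP; rewrite cards_eq0; apply/eqP/setP => x; rewrite !inE.
    by apply/eqP => E; move: (H x); lia.
  by rewrite !Z.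
case/tuple_permP => s Es; exists s => x.
have /(congr1 (fun t => nth 0 t x)) := Es.
by rewrite -!tnth_nth !tnth_mktuple.
Qed.

(** * Block sizes of equivalence relations *)

Definition eqr (T : Type) (e : rel T) : Prop :=
  [/\ reflexive e, symmetric e & transitive e].

Section Classes.
Variable n : nat.
Implicit Types (e : rel 'I_n) (U : {set 'I_n}).

Definition eclass e x : {set 'I_n} := [set y | e x y].
Definition eclasses e : {set {set 'I_n}} := [set eclass e x | x : 'I_n].
(** Written so that [ipart (sep v)] unfolds to [int_partition v]. *)
Definition ipart e : seq nat := [seq #|B| | B : {set 'I_n} <- enum (eclasses e)].
Definition eclass_index e x := index (eclass e x) (enum (eclasses e)).

Lemma eq_eclass e x y : eqr e -> (eclass e x == eclass e y) = e x y.
Proof.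
move=> [er es et]; apply/eqP/idP => [/setP/(_ y)|exy]; first by rewrite !inE er.
by apply/setP => z; rewrite !inE; apply/idP/idP; apply: et => //; rewrite es.
Qed.

Lemma mem_eclasses e x : eclass e x \in enum (eclasses e).
Proof. by rewrite mem_enum imset_f. Qed.

Lemma eq_eclass_index e x y : eqr e ->
  (eclass_index e x == eclass_index e y) = e x y.
Proof.
move=> eqe; rewrite -eq_eclass //; apply/eqP/eqP => [|E]; last by rewrite /eclass_index E.
by move/(congr1 (nth set0 (enum (eclasses e)))); rewrite !nth_index ?mem_eclasses.
Qed.

Lemma ipart_positive e : reflexive e -> positive_parts (ipart e).
Proof.
move=> er; apply/allP => k /mapP[B]; rewrite mem_enum => /imsetP[x _ ->] ->.
by apply/card_gt0P; exists x; rewrite inE er.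
Qed.

Lemma eclass_index_lab e : eqr e -> lab (eclass_index e) (ipart e).
Proof.
move=> eqe; split=> [x|k]; rewrite size_map; first by rewrite index_mem mem_eclasses.
move=> ltk; rewrite (nth_map set0) //; set B := nth _ _ _.
have /imsetP[x _ defB] : B \in eclasses e by rewrite -mem_enum mem_nth.
congr #|pred_of_set _|; apply/setP => y.
rewrite inE defB inE -eq_eclass_index // eq_sym; congr (_ == _).
by rewrite /eclass_index -defB index_uniq ?enum_uniq.
Qed.

Lemma lab_sumn (a : 'I_n -> nat) q : lab a q -> sumn q = n.
Proof.
move=> [a_lt aq]; rewrite -[RHS]card_ord -sum1_card -sumn_nth big_mkord.
rewrite (partition_big (fun x => Ordinal (a_lt x)) xpredT) //=.
by apply: eq_bigr => i _; rewrite -aq // -sum1_card; apply: eq_bigl => x; rewrite inE.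
Qed.

Lemma sumn_ipart e : eqr e -> sumn (ipart e) = n.
Proof. by move=> eqe; apply: lab_sumn (eclass_index_lab eqe). Qed.

Lemma lab_ipart (a : 'I_n -> nat) e q : positive_parts q -> lab a q ->
  (forall x y, e x y = (a x == a y)) -> perm_eq (ipart e) q.
Proof.
move=> pq [a_lt aq] ea; pose fib k := [set x | a x == k].
have q_fib : [seq #|fib k| | k <- iota 0 (size q)] = q.
  rewrite -[RHS](mkseq_nth 0); apply/eq_in_map => k; rewrite mem_iota => ltk.
  exact: aq.
rewrite -q_fib (map_comp (fun B : {set 'I_n} => #|B|)); apply: perm_map.
have pfib k : k < size q -> exists x, a x = k.
  move=> ltk; have: 0 < #|fib k| by rewrite aq //; apply: (all_nthP 0 pq).
  by case/card_gt0P => x; rewrite inE => /eqP; exists x.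
apply: uniq_perm; rewrite ?enum_uniq //.
  rewrite map_inj_in_uniq ?iota_uniq // => k l; rewrite !mem_iota => ltk _.
  have [x ax] := pfib k ltk.
  by move/setP/(_ x); rewrite !inE ax eqxx => /esym/eqP.
move=> B; rewrite mem_enum; apply/imsetP/mapP => [[x _ ->]|[k]].
  exists (a x); first by rewrite mem_iota a_lt.
  by apply/setP => y; rewrite !inE ea eq_sym.
rewrite mem_iota => ltk ->; have [x ax] := pfib k ltk.
by exists x => //; apply/setP => y; rewrite !inE ea ax eq_sym.
Qed.

Lemma ipart_sub e e' : eqr e -> eqr e' -> (forall x y, e x y -> e' x y) ->
  part_le (ipart e') (ipart e).
Proof.
move=> eqe eqe' sub; have [er _ _] := eqe; have [e'r _ _] := eqe'.
split; try exact: ipart_positive.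
apply: lab_refines (eclass_index_lab eqe) (eclass_index_lab eqe') _.
  exact: ipart_positive.
by move=> x y /eqP; rewrite eq_eclass_index // => /sub E; apply/eqP; rewrite eq_eclass_index.
Qed.

(** Grouping the blocks of [e] gives a labelling with the block sizes of [e']; a permutation matches
    it with the blocks of [e'] themselves. *)
Lemma part_le_ipart_perm e e' : eqr e -> eqr e' -> part_le (ipart e') (ipart e) ->
  exists s : 'S_n, forall x y, e (s x) (s y) -> e' x y.
Proof.
move=> eqe eqe' [_ _ /refinesP[f Hf]].
have [s Hs] := lab_perm (lab_ref_by (eclass_index_lab eqe) Hf) (eclass_index_lab eqe').
exists s => x y; rewrite -!(eq_eclass_index _ _ eqe) // -(eq_eclass_index _ _ eqe') !Hs.
by move=> /eqP E /=; rewrite E.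
Qed.

Lemma eqr_perm e (s : 'S_n) : eqr e -> eqr (fun x y => e (s x) (s y)).
Proof.
move=> [er es et]; split=> [x|x y|x y z]; [exact: er | exact: es | exact: et].
Qed.

Lemma ipart_perm e (s : 'S_n) : eqr e ->
  perm_eq (ipart (fun x y => e (s x) (s y))) (ipart e).
Proof.
move=> eqe; have [er _ _] := eqe; have [a_lt aq] := eclass_index_lab eqe.
apply: (@lab_ipart (eclass_index e \o s)); first exact: ipart_positive.
  split=> [x|k ltk]; first exact: a_lt.
  rewrite -aq // -[RHS](card_preimset _ (@perm_inj _ s)).
  by congr #|pred_of_set _|; apply/setP => x; rewrite !inE.
by move=> x y; rewrite /= eq_eclass_index.
Qed.

Definition ipart_on U e : seq nat :=
  [seq #|B| | B : {set 'I_n} <- enum [set eclass e x | x in U]].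

Lemma ipart_on_ext U e e' : (forall x y, x \in U -> e x y = e' x y) ->
  ipart_on U e = ipart_on U e'.
Proof.
move=> ee'; rewrite /ipart_on (eq_in_imset (g := eclass e')) // => x Ux.
by apply/setP => y; rewrite !inE ee'.
Qed.

Lemma ipart_split U e : eqr e -> (forall x y, e x y -> x \in U -> y \in U) ->
  perm_eq (ipart e) (ipart_on U e ++ ipart_on (~: U) e).
Proof.
move=> [er es et] sat; rewrite -map_cat; apply: perm_map.
apply: uniq_perm; rewrite ?cat_uniq ?enum_uniq ?andbT //=.
  apply/hasPn => B; rewrite !mem_enum => /imsetP[x xU ->].
  apply/imsetP => -[y yU /setP/(_ x)]; rewrite !inE er => /esym eyx.
  by move: xU; rewrite inE (sat _ _ eyx yU).
move=> B; rewrite mem_cat !mem_enum; apply/imsetP/orP.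
  move=> [x _ ->]; case: (boolP (x \in U)) => xU; [left|right]; rewrite imset_f //.
  by rewrite inE.
by case=> /imsetP[x _ ->]; exists x.
Qed.

Lemma sumn_ipart_on U e : eqr e -> (forall x y, e x y -> x \in U -> y \in U) ->
  sumn (ipart_on U e) = #|U|.
Proof.
move=> [er es et] sat; rewrite sumnE big_map big_enum /=.
have <- : equivalence_partition e U = [set eclass e x | x in U].
  apply: eq_in_imset => x xU; apply/setP => y; rewrite !inE.
  by case exy: (e x y); rewrite ?andbF // andbT (sat _ _ exy).
apply/esym/card_partition/equivalence_partitionP => x y z _ _ _; split=> // exy.
by apply/idP/idP; apply: et => //; rewrite es.
Qed.

Definition good (F : seq (seq nat)) e : Prop :=
  exists2 p, p \in F & part_le (ipart e) p.

Lemma good_sub F e e' : eqr e -> eqr e' -> (forall x y, e x y -> e' x y) ->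
  good F e -> good F e'.
Proof.
move=> eqe eqe' sub [p Fp le_p]; exists p => //.
exact: part_le_trans (ipart_sub eqe eqe' sub) le_p.
Qed.

(* Inside [U] the relation [e2] is refined to a copy of the member of [F]
   above it; this trades the block [U] of [e1] for parts of that member. *)
Lemma good_glue F e1 e2 U : special_family F ->
  (forall p, p \in F -> exists2 e, eqr e & p = ipart e) ->
  eqr e1 -> eqr e2 ->
  (forall x y, x \in U -> y \in U -> e1 x y) ->
  (forall x y, e1 x y -> x \in U -> y \in U) ->
  (forall x y, x \notin U -> y \notin U -> e2 x y) ->
  (forall x y, e2 x y -> x \in U -> y \in U) ->
  good F e1 -> good F e2 -> good F (fun x y => e1 x y && e2 x y).
Proof.
move=> spF Fe eq1 eq2 U1 sat1 U2 sat2 [p1 Fp1 le1] [p2 Fp2 le2].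
have [et eqet p2E] := Fe _ Fp2; rewrite p2E in le2.
have [s ste2] := part_le_ipart_perm eqet eq2 le2.
pose e3 x y := et (s x) (s y).
have eq3 : eqr e3 by exact: eqr_perm.
have sat3 x y : e3 x y -> x \in U -> y \in U by move/ste2; apply: sat2.
have [[r1 s1 t1] [r2 s2 t2] [r3 s3 t3]] := And3 eq1 eq2 eq3.
(* [e4] is [e1] outside [U] and the moved copy [e3] inside. It lies in both relations, since [e1] is
   total on [U], [e2] is total off [U] and [e3] refines [e2]. *)
pose e4 x y := ((x \in U) == (y \in U)) && (if x \in U then e3 x y else e1 x y).
have eq4 : eqr e4.
  split=> [x|x y|y x z]; rewrite /e4.
  - by rewrite eqxx r1 r3 if_same.
  - by rewrite eq_sym; case: eqP => //= ->; rewrite s1 s3.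
  - case: eqP => //= ->; case: eqP => //= ->; case: ifP => _; [exact: t3 | exact: t1].
have sat4 x y : e4 x y -> x \in U -> y \in U by case/andP => /eqP->.
have eqI : eqr (fun x y => e1 x y && e2 x y).
  split=> [x|x y|y x z]; first by rewrite r1 r2.
    by rewrite s1 s2.
  by move=> /andP[a b] /andP[c d]; rewrite (t1 _ _ _ a c) (t2 _ _ _ b d).
apply: (@good_sub _ e4) => // [x y /andP[/eqP xy]|].
  case: ifP xy => [Ux /esym Uy|/negbT Ux /esym/negbT Uy].
    by move/ste2; rewrite U1.
  by rewrite U2 // => ->.
have pos4 : positive_parts (ipart e4) by apply: ipart_positive; case: eq4.
pose r := ipart_on (~: U) e1 ++ ipart_on U e3.
have p4 : perm_eq (ipart e4) r.
  apply: perm_trans (ipart_split eq4 sat4) _.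
  rewrite perm_catC /r (@ipart_on_ext U e4 e3) ?(@ipart_on_ext (~: U) e4 e1) //.
    move=> x y; rewrite inE /e4 => /negPf Ux; rewrite Ux eq_sym eqbF_neg.
    case: (boolP (y \in U)) => //= Uy; apply/esym/negbTE.
    by apply: contraFN Ux; rewrite s1 => /sat1; apply.
  move=> x y; rewrite /e4 => Ux; rewrite Ux eq_sym eqb_id.
  case: (boolP (y \in U)) => //= Uy; apply/esym/negbTE.
  by apply: contraNN Uy => /sat3; apply.
suff [pj Fpj le_r] : exists2 pj, pj \in F & part_le r pj.
  by exists pj => //; apply: part_le_trans le_r; apply: part_le_perm p4.
apply: spF; apply: (@repl_step _ (ipart e1)); first exact: repl_base Fp1 le1.
(* The parts of [e1] inside [U] and those of the moved copy of [p2] inside [U] both sum to the size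
   of [U]. *)
exists p2; split=> //.
exists (ipart_on (~: U) e1), (ipart_on U e1), (ipart_on U e3), (ipart_on (~: U) e3).
split=> //.
- by rewrite perm_sym perm_catC perm_sym; apply: ipart_split.
- by rewrite p2E perm_sym -(permPr (ipart_perm s eqet)) perm_sym; apply: ipart_split.
- by rewrite !sumn_ipart_on.
Qed.

End Classes.

(** * Rooted trees *)

Section Rooted.
Variable V : finType.
Implicit Types (e : rel V) (r x y z : V) (par : V -> V).

(** The measure [d] may be any function that decreases towards the parent, which rules out cycles.
    The root is its own parent, so [par] is total. *)
Definition rooted e r par (d : V -> nat) : Prop :=
  [/\ par r = r, forall x, x != r -> d (par x) < d x
    & forall x y, e x y = ((x != r) && (y == par x)) || ((y != r) && (x == par y))].

Definition parent_edges r par : {set V * V} :=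
  [set (x, par x) | x in [set~ r]] :|: [set (par x, x) | x in [set~ r]].

(** The two orientations give disjoint sets: two vertices that are parents of each other would have
    depth decreasing both ways. *)
Lemma card_parent_edges r par (d : V -> nat) :
  (forall x, x != r -> d (par x) < d x) ->
  #|parent_edges r par| = 2 * #|V|.-1.
Proof.
move=> dpar; rewrite /parent_edges cardsU !card_imset; try by move=> x y [].
rewrite [X in _ - X](_ : _ = 0) ?subn0 ?cardsC1 ?addnn ?mul2n //.
apply/eqP; rewrite cards_eq0 -subset0; apply/subsetP => p.
rewrite !inE => /andP[/imsetP[x]]; rewrite !inE => xr -> /imsetP[y].
rewrite !inE => yr [xE yE]; have := dpar _ xr; have := dpar _ yr.
by rewrite -xE yE; lia.
Qed.

Lemma mem_parent_edges r par p : (p \in parent_edges r par) =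
  ((p.1 != r) && (p.2 == par p.1)) || ((p.2 != r) && (p.1 == par p.2)).
Proof.
case: p => x y; rewrite inE /=; congr (_ || _).
  apply/imsetP/andP => [[z] | [xr /eqP->]]; last by exists x; rewrite ?inE.
  by rewrite !inE => zr [-> ->].
apply/imsetP/andP => [[z] | [yr /eqP->]]; last by exists y; rewrite ?inE.
by rewrite !inE => zr [-> ->].
Qed.

(* A breadth-first spanning tree already uses all [2 (|V| - 1)] darts. *)
Lemma tree_rooted e r : symmetric e -> (forall x y, connect e x y) ->
  #|[set p : V * V | e p.1 p.2]| = 2 * #|V|.-1 ->
  exists par d, rooted e r par d.
Proof.
move=> es ec eN.
have D_ex x : exists k, [exists p : k.-tuple V, path e r p && (last r p == x)].
  have [p ep ->] := connectP (ec r x); exists (size p); apply/existsP.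
  by exists (in_tuple p); rewrite ep eqxx.
pose d x := ex_minn (D_ex x).
have step x : x != r -> exists y, e x y && (d y < d x).
  rewrite /d; case: ex_minnP => k /existsP[p /andP[ep /eqP lp]] _ xr.
  case/lastP: {p} (tval p) (size_tuple p) ep lp => [|p x'].
    by move=> _ _ rx; rewrite -rx eqxx in xr.
  rewrite size_rcons rcons_path last_rcons => szp /andP[ep elx] x'x.
  subst x'; exists (last r p); rewrite es elx.
  case: ex_minnP => m _ min_m; rewrite -szp ltnS; apply: min_m.
  by apply/existsP; exists (in_tuple p); rewrite ep /=.
pose par x := if x == r then r else odflt r [pick y | e x y && (d y < d x)].
have parP x : x != r -> e x (par x) && (d (par x) < d x).
  move=> xr; rewrite /par (negPf xr); case: pickP => //= no.
  by have [y] := step x xr; rewrite no.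
have dpar x : x != r -> d (par x) < d x by case/parP/andP.
exists par, d; split=> // [|x y]; first by rewrite /par eqxx.
suff /setP/(_ (x, y)) : parent_edges r par = [set p | e p.1 p.2].
  by rewrite mem_parent_edges inE.
apply/eqP; rewrite eqEcard eN (card_parent_edges dpar) leqnn andbT.
apply/subsetP => -[a b]; rewrite mem_parent_edges inE /=.
by case/orP => /andP[/parP/andP[eab _] /eqP->]; rewrite // es.
Qed.

Variables (e : rel V) (r : V) (par : V -> V) (d : V -> nat).
Hypothesis rt : rooted e r par d.

Let par_r : par r = r. Proof. by case: rt. Qed.
Let d_par x : x != r -> d (par x) < d x. Proof. by case: rt => _ /(_ x). Qed.

Lemma rooted_adj x y :
  e x y = ((x != r) && (y == par x)) || ((y != r) && (x == par y)).
Proof. by case: rt. Qed.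

Lemma rooted_par x : x != r -> e x (par x).
Proof. by move=> xr; rewrite rooted_adj xr eqxx. Qed.

Lemma rooted_adj_root x : e r x = (x != r) && (par x == r).
Proof. by rewrite rooted_adj eqxx /= [r == _]eq_sym. Qed.

Lemma rooted_sym : symmetric e.
Proof. by move=> x y; rewrite !rooted_adj orbC. Qed.

Lemma rooted_irr : irreflexive e.
Proof.
move=> x; rewrite rooted_adj orbb; apply/negP => /andP[/d_par + /eqP E].
by rewrite -E ltnn.
Qed.

Lemma rooted_card : #|[set p : V * V | e p.1 p.2]| = 2 * #|V|.-1.
Proof.
rewrite -(card_parent_edges d_par); congr #|pred_of_set _|.
by apply/setP => p; rewrite mem_parent_edges inE rooted_adj.
Qed.

Notation anc := (fconnect par).

Lemma anc_par x : anc x (par x).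
Proof. exact: fconnect1. Qed.

Lemma anc_step x y : anc x y -> x = y \/ x != r /\ anc (par x) y.
Proof.
case/connectP => -[|z p] /= => [_ ->|/andP[/eqP <- pp] yl]; first by left.
have zy : anc (par x) y by apply/connectP; exists p.
have [xr|] := eqVneq x r; last by right.
left; move: zy; rewrite xr par_r => /iter_findex <-.
by elim: (findex _ _ _) => //= k <-.
Qed.

Lemma anc_root x : anc x r.
Proof.
elim: {x}_.+1 {-2}x (ltnSn (d x)) => // m IH x; rewrite ltnS => dx.
have [->|xr] := eqVneq x r; first exact: connect0.
by apply: connect_trans (anc_par x) (IH _ _); apply: leq_trans (d_par xr) dx.
Qed.

Lemma anc_connect x y : anc x y -> connect e x y.
Proof.
apply: connect_sub => a b /eqP <-; have [->|ar] := eqVneq a r.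
  by rewrite par_r connect0.
exact/connect1/rooted_par.
Qed.

Lemma par_neq x : x != r -> par x != x.
Proof. by move/d_par; apply: contraTneq => ->; rewrite ltnn. Qed.

Lemma anc_d x y : anc x y -> d y <= d x.
Proof.
move/iter_findex <-; elim: (findex _ _ _) => //= k; apply: leq_trans.
set z := iter k par x; have [->|/d_par/ltnW//] := eqVneq z r.
by rewrite par_r.
Qed.

Lemma anc_anti x y : anc x y -> anc y x -> x = y.
Proof.
move=> xy yx; have [//|[xr /anc_d h]] := anc_step xy.
by have := d_par xr; have := anc_d yx; lia.
Qed.

Lemma anc_r x : anc r x -> x = r.
Proof. by move=> rx; apply/esym/anc_anti => //; apply: anc_root. Qed.

Lemma anc_chain x y z : anc x y -> anc x z -> anc y z \/ anc z y.
Proof.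
move=> /iter_findex <- /iter_findex <-.
move: (findex _ _ _) (findex _ _ _) => k l.
by have [le|/ltnW le] := leqP k l; [right|left]; rewrite -(subnK le) iterD;
  apply: fconnect_iter.
Qed.

Lemma anc_strict x y : anc x y -> x != y -> x != r /\ anc (par x) y.
Proof. by case/anc_step => [->|//]; rewrite eqxx. Qed.

Lemma child_towards x y : anc y x -> y != x ->
  exists c, [/\ c != r, par c = x & anc y c].
Proof.
elim: {y}_.+1 {-2}y (ltnSn (d y)) => // m IH y; rewrite ltnS => dy yx yNx.
have [yr pyx] := anc_strict yx yNx.
have [px|px] := eqVneq (par y) x; first by exists y.
have [|//|//|c [cr pc yc]] := IH (par y); first exact: leq_trans (d_par yr) dy.
by exists c; split=> //; apply: connect_trans (anc_par y) yc.
Qed.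

Definition avoid w : rel V := fun x y => [&& x != w, y != w & e x y].

Lemma avoid_sym w : symmetric (avoid w).
Proof. by move=> x y; rewrite /avoid rooted_sym; do 2!case: eqP. Qed.

(** The only edge out of the subtree of [z] leads to [par z], which is removed. *)
Lemma avoid_below z x y : z != r -> connect (avoid (par z)) x y ->
  anc x z -> anc y z.
Proof.
move=> zr /connectP[p + ->]; elim: p x => //= a p IH x.
case/andP => /and3P[xz az exa] pp xanc; apply: IH pp _.
move: exa; rewrite rooted_adj => /orP[/andP[xr /eqP aE]|/andP[_ /eqP xE]].
  have [xz'|] := eqVneq x z; first by rewrite aE xz' eqxx in az.
  by case/(anc_strict xanc) => _; rewrite aE.
by apply: connect_trans xanc; rewrite xE; apply: anc_par.
Qed.

(** Here [z] itself is removed, and a path starting strictly below it could leave its subtree only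
    through it. *)
Lemma avoid_stays_below z x y : z != r -> connect (avoid z) x y ->
  x != z -> anc x z -> anc y z.
Proof.
move=> zr /connectP[p + ->]; elim: p x => //= a p IH x.
case/andP => /and3P[xz az exa] pp _ xanc; apply: IH pp az _.
move: exa; rewrite rooted_adj => /orP[/andP[xr /eqP aE]|/andP[_ /eqP xE]].
  by case: (anc_strict xanc xz) => _; rewrite aE.
by apply: connect_trans xanc; rewrite xE; apply: anc_par.
Qed.

Lemma avoid_climb w x y : anc x y ->
  (forall z, anc x z -> anc z y -> z != w) -> connect (avoid w) x y.
Proof.
move/iter_findex; move: (findex _ _ _) => k; elim: k x => [|k IH] x /=.
  by move=> ->; rewrite connect0.
rewrite -iterS iterSr => kE nw.
have pxy : anc (par x) y by rewrite -kE fconnect_iter.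
have xy : anc x y := connect_trans (anc_par x) pxy.
have cpy : connect (avoid w) (par x) y.
  by apply: IH => // z pxz zy; apply: nw => //; apply: connect_trans (anc_par x) pxz.
have [xr|xr] := eqVneq x r; first by move: cpy; rewrite xr par_r.
apply: connect_trans cpy; apply: connect1.
by rewrite /avoid rooted_par // !nw ?connect0 // anc_par.
Qed.

End Rooted.

(** * Separation of leaves by a vertex *)

Lemma path_avoid (V : finType) (e : rel V) z a p : path e a p -> z \notin a :: p ->
  connect (avoid e z) a (last a p).
Proof.
elim: p a => //= b p IH a /andP[eab pp]; rewrite !inE !negb_or => /and3P[za zb zp].
apply: connect_trans (IH _ pp _); last by rewrite inE negb_or zb.
by apply: connect1; rewrite /avoid eab ![_ == z]eq_sym za zb.
Qed.

Lemma connect_avoid_neq (V : finType) (e : rel V) z a b :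
  connect (avoid e z) a b -> a != z -> b != z.
Proof.
by case/connectP => p + ->; elim: p a => //= c p IH a /andP[/and3P[_ cz _] /IH]; auto.
Qed.

Definition sep n (G : tree_data n) (v : 'I_(nint G)) : rel 'I_n :=
  fun i j => connect (adj_minus v) (inl i) (inl j).

Section Separation.
Variables (n : nat) (G : tree_data n).
Implicit Types (r v w x y z : 'I_(nint G)) (i j : 'I_n).

Definition node (x : 'I_n + 'I_(nint G)) : 'I_(nint G) :=
  match x with inl i => att G i | inr w => w end.

Lemma adj_minus_node v (x y : _ + _) : adj_minus v x y ->
  node x != v /\ connect (avoid (adj G) v) (node x) (node y).
Proof.
case: x y => [i|a] [j|b] /and3P[] //=.
- by move=> _ bv /eqP->; split.
- by move=> av _ /eqP->; split.
- by move=> av bv ab; split=> //; apply: connect1; rewrite /avoid ab av bv.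
Qed.

(** A leaf meets only the vertex that carries it, so [node] projects walks to internal vertices. A
    leaf carried by [v] becomes isolated, hence the case [i == j]. *)
Lemma sepE v i j : sep v i j =
  (i == j) || (att G i != v) && connect (avoid (adj G) v) (att G i) (att G j).
Proof.
apply/idP/idP => [|/orP[/eqP->|/andP[iv cij]]]; last 2 first.
- exact: connect0.
- have jv := connect_avoid_neq cij iv.
  apply: (@connect_trans _ _ (inr (att G i))).
    by apply: connect1; rewrite /adj_minus /= eqxx andbT.
  apply: (@connect_trans _ _ (inr (att G j))); last first.
    by apply: connect1; rewrite /adj_minus /= eqxx !andbT.
  case/connectP: cij => p + ->; elim: p (att G i) => //= a p IH x.
  case/andP => /and3P[xv av xa] /IH; apply: connect_trans.
  by apply: connect1; rewrite /adj_minus /= xa andbT; apply/andP.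
suff H (x y : _ + _) : connect (adj_minus v) x y -> x = y \/
    node x != v /\ connect (avoid (adj G) v) (node x) (node y).
  by case/H => [[->]|[/= iv cij]]; rewrite ?eqxx // iv cij orbT.
case/connectP => p + ->; elim: p x => [|a p IH] x /=; first by left.
case/andP => /adj_minus_node[xv xa] /IH h; right; split=> //.
by apply: connect_trans xa _; case: h => [<-|[]].
Qed.

Lemma sep_eqr v : symmetric (adj G) -> eqr (sep v).
Proof.
move=> adjs; split=> [i|i j|j i k]; [exact: connect0| |exact: connect_trans].
apply: sym_connect_sym => -[a|a] [b|b]; rewrite /adj_minus /= 1?adjs //.
by rewrite andbCA.
Qed.

(** Leaves and vertices in one set, so that the degree bound yields three distinct neighbours of
    either kind. *)
Definition incident w : {set 'I_n + 'I_(nint G)} :=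
  (inl @: [set i | att G i == w]) :|: (inr @: [set u | adj G w u]).

Lemma card_incident w :
  #|incident w| = #|[set u | adj G w u]| + #|[set i | att G i == w]|.
Proof.
rewrite /incident cardsU !card_imset; try by move=> ? ? [].
rewrite [X in _ - X](_ : _ = 0) ?subn0 1?addnC //.
apply/eqP; rewrite cards_eq0 -subset0; apply/subsetP => x.
by rewrite !inE => /andP[/imsetP[i _ ->] /imsetP[]].
Qed.

Lemma incident_leaf w i : (inl i \in incident w) = (att G i == w).
Proof.
rewrite inE; apply/orP/idP => [[/imsetP[j + [->]]|/imsetP[//]]|iw].
  by rewrite inE.
by left; apply: imset_f; rewrite inE.
Qed.

Lemma incident_vertex w u : (inr u \in incident w) = adj G w u.
Proof.
rewrite inE; apply/orP/idP => [[/imsetP[//]|/imsetP[v + [->]]]|wu].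
  by rewrite inE.
by right; apply: imset_f; rewrite inE.
Qed.

Section SepRooted.
Variables (r : 'I_(nint G)) (par : 'I_(nint G) -> 'I_(nint G)).
Variable d : 'I_(nint G) -> nat.
Hypothesis rt : rooted (adj G) r par d.
Notation anc := (fconnect par).

Definition below z : {set 'I_n} := [set i | anc (att G i) z].

Lemma belowS x y : anc x y -> below x \subset below y.
Proof.
by move=> xy; apply/subsetP => i; rewrite !inE => ix; apply: connect_trans ix xy.
Qed.

Lemma below_root : below r = [set: 'I_n].
Proof. by apply/setP => i; rewrite !inE (anc_root rt). Qed.

(** Both leaves climb to [y] inside its subtree, and [w] lies outside that subtree. *)
Lemma sep_in w y i j : i \in below y -> j \in below y -> ~~ anc w y -> sep w i j.
Proof.
rewrite !inE => iy jy wy; rewrite sepE; apply/orP; right.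
have nw z : anc z y -> z != w by apply: contraTneq => ->.
rewrite nw //=; apply: (@connect_trans _ _ y).
  by apply: (avoid_climb rt) => // z _ /nw.
rewrite (sym_connect_sym (avoid_sym rt w)).
by apply: (avoid_climb rt) => // z _ /nw.
Qed.

(** Both leaves climb to the root; a chain of parents starting outside the subtree of [w] never
    meets [w]. *)
Lemma sep_out w i j : i \notin below w -> j \notin below w -> sep w i j.
Proof.
rewrite !inE => iw jw; rewrite sepE; apply/orP; right.
have nw i' : ~~ anc (att G i') w -> connect (avoid (adj G) w) (att G i') r.
  move=> h; apply: (avoid_climb rt); first exact: (anc_root rt).
  by move=> z iz _; apply: contraNneq h => <-.
apply/andP; split; first by apply: contraNneq iw => ->.
apply: connect_trans (nw _ iw) _.
by rewrite (sym_connect_sym (avoid_sym rt w)); apply: nw.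
Qed.

Lemma sep_root i j : sep r i j =
  (i == j) || [exists z, [&& z != r, i \in below z & j \in below z]].
Proof.
apply/idP/orP => [|[/eqP->|/existsP[z /and3P[zr iz jz]]]].
- rewrite sepE => /orP[->|/andP[ir cij]]; [by left|right; apply/existsP].
  have [z [zr pz iz]] := child_towards rt (anc_root rt _) ir.
  exists z; rewrite !inE zr iz /=; apply: (avoid_below rt) iz => //.
  by rewrite pz.
- exact: connect0.
- apply: sep_in iz jz _; apply: contraNN zr => /(anc_r rt)->; exact: eqxx.
Qed.

Lemma sep_root_child z i j : z != r -> par z = r ->
  sep r i j -> i \in below z -> j \in below z.
Proof.
rewrite sepE !inE => zr pz /orP[/eqP->//|/andP[_ cij]] iz.
by apply: (avoid_below rt) iz => //; rewrite pz.
Qed.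

Lemma eclass_sep_root z i : z != r -> par z = r -> i \in below z ->
  eclass (sep r) i = below z.
Proof.
move=> zr pz iz; apply/setP => j; rewrite inE.
apply/idP/idP => [s|jz]; first exact: sep_root_child s iz.
by rewrite sep_root; apply/orP; right; apply/existsP; exists z; rewrite zr iz jz.
Qed.

Lemma below_par z : below z \subset below (par z).
Proof. exact: belowS (anc_par _ _). Qed.

Lemma child_containing x i : i \in below x ->
  att G i = x \/ exists c, [/\ c != r, par c = x & i \in below c].
Proof.
rewrite inE => ix; have [->|iNx] := eqVneq (att G i) x; [by left|right].
by have [c [cr pc ic]] := child_towards rt ix iNx; exists c; rewrite inE.
Qed.

(** The point is the degree bound. At the root, three pairwise separated leaves lie in three
    directions. Elsewhere the parent is one neighbour, and the leaves below [w] need two more: there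
    are at least two of them and no child has all of them below it. *)
Lemma rooted_stable :
  (forall x, 1 < #|below x|) ->
  (forall x, x != r -> below x != below (par x)) ->
  (exists i j k, [/\ ~~ sep r i j, ~~ sep r j k & ~~ sep r k i]) ->
  is_stable_tree G.
Proof.
move=> gt1 strict three; split.
- by case: (nint G) r => // -[].
- by split; [exact: (rooted_sym rt) | exact: (rooted_irr rt)].
- move=> x y; apply: (@connect_trans _ _ r).
    exact: (anc_connect rt (anc_root rt x)).
  by rewrite (sym_connect_sym (rooted_sym rt)); apply: (anc_connect rt (anc_root rt y)).
- by rewrite (rooted_card rt) card_ord.
move=> w; rewrite -card_incident.
have towards i : i \in below w -> exists t, t \in incident w /\
    match t with inl j => i = j
    | inr c => [/\ c != r, par c = w & i \in below c] end.
  case/child_containing => [iw|[c [cr pc ic]]].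
    by exists (inl i); rewrite incident_leaf iw eqxx.
  by exists (inr c); rewrite incident_vertex (rooted_sym rt) -pc (rooted_par rt).
have [wr|wr] := eqVneq w r.
  have [i [j [k [sij sjk ski]]]] := three.
  have inw l : l \in below w by rewrite wr below_root inE.
  have dist a b t u : ~~ sep r a b ->
      match t with inl j => a = j
      | inr c => [/\ c != r, par c = w & a \in below c] end ->
      match u with inl j => b = j
      | inr c => [/\ c != r, par c = w & b \in below c] end -> t != u.
    move=> sab tP uP; apply: contraNneq sab => tu; subst u.
    case: t tP uP => [l -> ->|c [cr _ ac] [_ _ bc]]; first exact: connect0.
    by rewrite sep_root; apply/orP; right; apply/existsP; exists c; rewrite cr ac bc.
  have [[t [tw tP]] [u [uw uP]] [v [vw vP]]] :=
    And3 (towards _ (inw i)) (towards _ (inw j)) (towards _ (inw k)).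
  apply/card_gt2P; exists t, u, v; split=> //.
  by split; [exact: dist sij tP uP | exact: dist sjk uP vP | exact: dist ski vP tP].
have parw : inr (par w) \in incident w by rewrite incident_vertex (rooted_par rt).
have par_dist c : par c = w -> inr c != inr (par w) :> 'I_n + 'I_(nint G).
  move=> pc; apply: contraNneq (par_neq rt wr) => -[cE].
  apply/eqP/(anc_anti rt); last exact: anc_par.
  by rewrite -{2}pc cE; apply: anc_par.
have /card_gt0P[i iw] : 0 < #|below w| := ltnW (gt1 w).
have [t [tw tP]] := towards i iw.
(* A second leaf below [w] that does not lie in the direction [t]. *)
have [j jw] : exists2 j, j \in below w &
    match t with inl i => j != i | inr c => j \notin below c end.
  case: t tw tP => [_ _ <-|c _ [cr pc ic]].
    have : ~~ (below w \subset [set i]).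
      by apply: contraTN (gt1 w) => /subset_leq_card; rewrite cards1 -leqNgt.
    by case/subsetPn => j jw; rewrite inE; exists j.
  suff /subsetPn[j] : ~~ (below w \subset below c) by exists j.
  apply: contra (strict c cr) => wc; rewrite eqEsubset below_par pc.
  exact: wc.
have [u [uw uP]] := towards j jw => jt.
apply/card_gt2P; exists t, u, (inr (par w)); split=> //; split.
- apply: contraTneq isT => tu; subst u; move: jt.
  by case: t {tw uw} tP uP => [l _ ->|c _ [_ _ ->]]; rewrite ?eqxx.
- by case: u uP {uw} => // c [_ pc _]; apply: par_dist.
- by rewrite eq_sym; case: t tP {tw jt} => // c [_ pc _]; apply: par_dist.
Qed.

Hypothesis st : is_stable_tree G.

(** A deepest vertex [y] below [x] has no children, so its only possible vertex neighbour is its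
    parent, and stability forces two leaves at [y]. *)
Lemma below_gt1 x : 1 < #|below x|.
Proof.
have [y yx ymax] := @arg_maxnP _ x (fun y => anc y x) d (connect0 _ x).
case: st => _ _ _ _ /(_ y).
have A1 : #|[set u | adj G y u]| <= 1.
  rewrite -(cards1 (par y)); apply/subset_leq_card/subsetP => u; rewrite !inE.
  rewrite (rooted_adj rt) => /orP[/andP[]//|/andP[ur /eqP yE]].
  have /ymax : anc u x by apply: connect_trans yx; rewrite yE; apply: anc_par.
  by case: rt => _ /(_ _ ur) + _; rewrite -yE => lt le; move: (leq_trans lt le); rewrite ltnn.
have : #|[set i | att G i == y]| <= #|below x|.
  by apply/subset_leq_card/subsetP => i; rewrite !inE => /eqP->.
lia.
Qed.

(** By stability leaf sets determine vertices: were [y] strictly below [x], all leaves below [x]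
    would lie under one child and [x] would have degree at most two. *)
Lemma below_anc x y : below x \subset below y -> anc x y.
Proof.
move=> sxy; have /card_gt0P[i ix] : 0 < #|below x| := ltnW (below_gt1 x).
have iy := subsetP sxy _ ix; move: ix iy; rewrite !inE => ix iy.
have [//|yx] := anc_chain ix iy.
have [->|yNx] := eqVneq y x; first exact: connect0.
have [c [cr pc yc]] := child_towards rt yx yNx.
case: st => _ _ _ _ /(_ x).
have [->|[j]] := set_0Vmem [set i | att G i == x]; last first.
  by rewrite inE => /eqP jx _; have := subsetP sxy j; rewrite !inE jx connect0 => ->.
rewrite cards0 addn0 => deg.
(* A third neighbour of [x] is a second child [c']; a leaf below it would also lie below [y], hence
   below [c], making the siblings comparable. *)
have /subsetPn[c' xc'] : ~~ ([set u | adj G x u] \subset [set par x; c]).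
  by apply: contraTN deg => /subset_leq_card; rewrite cards2; case: eqP => _ /=; lia.
rewrite !inE negb_or => /andP[c'px c'c]; move: xc'; rewrite inE (rooted_adj rt).
case/orP => /andP[]; first by rewrite (negPf c'px).
move=> c'r /eqP pc'; exfalso.
have /card_gt0P[j jc'] : 0 < #|below c'| := ltnW (below_gt1 c').
have jx : j \in below x by apply: subsetP jc'; apply: belowS; rewrite pc'; apply: anc_par.
have := subsetP sxy _ jx; move: jc'; rewrite !inE => jc' jy.
have anti a b : par a = x -> par b = x -> a != b -> a != r -> b != r -> anc a b -> False.
  move=> pa pb ab ar br /(anc_strict rt)/(_ ab)[_]; rewrite pa -pb => h.
  have := anc_anti rt h (anc_par _ _) => E; move: (rooted_par rt br).
  by rewrite E (rooted_irr rt).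
have [] := anc_chain jc' (connect_trans jy yc); apply: anti => //.
by rewrite eq_sym.
Qed.

End SepRooted.

Hypothesis st : is_stable_tree G.

Lemma stable_rooted r : exists par d, rooted (adj G) r par d.
Proof.
case: st => _ [adjs _] adjc adjN _; apply: tree_rooted => //.
by rewrite adjN card_ord.
Qed.

Lemma stable_sep_eqr v : eqr (sep v).
Proof. by case: st => _ [adjs _] _ _ _; apply: sep_eqr. Qed.

(** One leaf is chosen in each of three directions at [w]. *)
Lemma three_separated w : exists i j k,
  [/\ ~~ sep w i j, ~~ sep w j k & ~~ sep w k i].
Proof.
have [par [d rt]] := stable_rooted w.
have cX : 2 < #|incident w| by rewrite card_incident; case: st => _ _ _ _ /(_ w).
pose Q (x : 'I_n + 'I_(nint G)) i :=
  match x with inl j => i = j | inr z => i \in below par z end.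
have exQ (x : _ + _) : exists i, Q x i.
  case: x => [i|z]; first by exists i.
  by have /card_gt0P[i iz] : 0 < #|below par z| := ltnW (below_gt1 rt st z); exists i.
have child z : inr z \in incident w -> z != w /\ par z = w.
  by rewrite incident_vertex (rooted_adj_root rt) => /andP[-> /eqP].
have leaf i : inl i \in incident w -> att G i = w.
  by rewrite incident_leaf => /eqP.
have mixed i z k : inl i \in incident w -> inr z \in incident w ->
    k \in below par z -> ~~ sep w i k.
  move=> /leaf iw /child[zw pz]; rewrite inE => kz; rewrite sepE iw eqxx orbF.
  apply: contraNneq zw => ik; rewrite -ik iw in kz.
  by rewrite (anc_r rt kz).
have QX (x y : _ + _) k l : x \in incident w -> y \in incident w ->
    Q x k -> Q y l -> x != y -> ~~ sep w k l.
  case: x y => [i|z] [j|t] xX yX /=.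
  - by move=> -> -> ij; rewrite sepE (leaf _ xX) eqxx orbF; apply: contraNneq ij => ->.
  - by move=> -> lt _; apply: mixed lt.
  - by move=> kz -> _; have [_ -> _] := stable_sep_eqr w; apply: mixed kz.
  - move=> kz lt zt; have [[zw pz] [tw pt]] := (child _ xX, child _ yX).
    apply/negP => skl; have lz := sep_root_child rt zw pz skl kz.
    move: lz lt; rewrite !inE => lz lt.
    have anti a b : par a = w -> a != b -> b != w ->
      fconnect par a b -> False.
      move=> pa ab bw /(anc_strict rt)/(_ ab)[_]; rewrite pa => /(anc_r rt) E.
      by rewrite E eqxx in bw.
    have zt' : z != t by apply: contraNneq zt => ->.
    by have [] := anc_chain lz lt; apply: anti; rewrite // eq_sym.
have /card_gt2P[x [y [z [[xX yX zX] [xy yz zx]]]]] := cX.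
have [[i xi] [j yj] [k zk]] := And3 (exQ x) (exQ y) (exQ z).
by exists i, j, k; split; [apply: QX xy|apply: QX yz|apply: QX zx].
Qed.

Definition restr (S : {set 'I_(nint G)}) : rel 'I_(nint G) :=
  fun x y => [&& x \in S, y \in S & adj G x y].

Lemma restr_sym S : symmetric (restr S).
Proof.
by case: st => _ [adjs _] _ _ _ x y; rewrite /restr adjs andbCA.
Qed.

(* The witness [U] is the set of leaves on the [w]-side of the edge [s w]. *)
Lemma sep_edge (S : {set 'I_(nint G)}) s w : s \in S -> w \notin S -> adj G s w ->
  (forall u, u \in S -> connect (restr S) u s) ->
  exists U : {set 'I_n},
    [/\ forall i j, i \in U -> j \in U -> forall u, u \in S -> sep u i j,
        forall i j, (forall u, u \in S -> sep u i j) -> i \in U -> j \in U,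
        forall i j, i \notin U -> j \notin U -> sep w i j
      & forall i j, sep w i j -> i \in U -> j \in U].
Proof.
move=> sS wS esw conS; have [par [d rt]] := stable_rooted s.
have [ws pw] : w != s /\ par w = s.
  by move: esw; rewrite (rooted_adj_root rt) => /andP[-> /eqP].
exists (below par w); split=> [i j iw jw u uS|i j sij iw|i j|i j].
- apply: (sep_in rt iw jw); apply/negP => uw.
  have cus : connect (avoid (adj G) w) u s.
    have := conS _ uS; apply: connect_sub => x y /and3P[xS yS xy].
    apply: connect1; rewrite /avoid xy andbT.
    by apply/andP; split; apply: contraNneq wS => <-.
  have uNw : u != w by apply: contraNneq wS => <-.
  have := avoid_stays_below rt ws cus uNw uw => /(anc_r rt) E.
  by rewrite E eqxx in ws.
- exact: (sep_root_child rt ws pw (sij _ sS)) iw.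
- exact: (sep_out rt).
- rewrite sepE => /orP[/eqP->//|/andP[iNw cij]]; rewrite !inE => iw.
  exact: (avoid_stays_below rt ws cij iNw iw).
Qed.

(** The set grows from [c] by one vertex at a time: connectedness supplies an edge leaving it, and
    [sep_edge] cuts the leaves along that edge as [good_glue] requires. *)
Lemma good_connected F (C : {set 'I_(nint G)}) c : special_family F ->
  (forall p, p \in F -> exists2 e : rel 'I_n, eqr e & p = ipart e) ->
  c \in C -> (forall u, u \in C -> connect (restr C) u c) ->
  (forall u, u \in C -> good F (sep u)) ->
  good F (fun i j => [forall u in C, sep u i j]).
Proof.
move=> spF Fe cC conC gC.
have eqS (S : {set 'I_(nint G)}) : eqr (fun i j => [forall u in S, sep u i j]).
  split=> [i|i j|j i k].
  - by apply/forall_inP => u _; apply: connect0.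
  - by apply: eq_forallb_in => u _; have [_ -> _] := stable_sep_eqr u.
  - move=> /forall_inP a /forall_inP b; apply/forall_inP => u uS.
    exact: connect_trans (a u uS) (b u uS).
suff H m : m < #|C| -> exists S : {set 'I_(nint G)}, [/\ S \subset C, #|S| = m.+1, c \in S,
    forall u, u \in S -> connect (restr S) u c &
    good F (fun i j => [forall u in S, sep u i j])].
  have C0 : 0 < #|C| by apply/card_gt0P; exists c.
  have [|S [SC cS _ _]] := H #|C|.-1; first by rewrite prednK.
  by have/eqP-> : S == C by rewrite eqEcard SC cS prednK /=.
elim: m => [_|m IH ltm].
  exists [set c]; split; rewrite ?sub1set ?cards1 ?set11 //.
    by move=> u /set1P->; apply: connect0.
  apply: good_sub (gC _ cC) => [|//|i j s]; first exact: stable_sep_eqr.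
  by apply/forall_inP => u /set1P->.
have [|S [SC cS cinS conS gS]] := IH; first exact: ltnW.
have /subsetPn[u uC uS] : ~~ (C \subset S).
  by apply: contraTN ltm => /subset_leq_card; rewrite cS -leqNgt.
(* The path from [u] to [c] starts outside [S] and ends inside; this is its first edge entering
   [S]. *)
have [w [s [wC wS sS ews]]] : exists w s, [/\ w \in C, w \notin S, s \in S & adj G w s].
  have /connectP[p + pc] := conC u uC.
  elim: p u uS uC pc => [|a p IHp] u uS uC /= pc; first by rewrite -pc cinS in uS.
  case/andP => /and3P[_ aC ea] pp; case: (boolP (a \in S)) => aS.
    by exists u, a.
  exact: IHp pp.
have [adjs _] : symmetric (adj G) /\ irreflexive (adj G) by case: st.
have conSs v : v \in S -> connect (restr S) v s.
  move=> vS; apply: connect_trans (conS v vS) _.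
  by rewrite (sym_connect_sym (restr_sym S)); apply: conS.
have esw : adj G s w by rewrite adjs.
have [U [U1 U2 U3 U4]] := sep_edge sS wS esw conSs.
exists (w |: S); split.
- by rewrite subUset sub1set wC.
- by rewrite cardsU1 wS cS.
- by rewrite inE cinS orbT.
- have cS' v : v \in S -> connect (restr (w |: S)) v c.
    move/conS; apply: connect_sub => x y /and3P[xS yS xy]; apply: connect1.
    by rewrite /restr !inE xS yS xy !orbT.
  move=> v; rewrite !inE => /orP[/eqP->|/cS'//].
  apply: connect_trans (cS' _ sS); apply: connect1.
  by rewrite /restr !inE eqxx sS ews orbT.
- have := good_glue spF Fe (eqS S) (stable_sep_eqr w) _ _ U3 U4 gS (gC _ wC).
  move=> /(_ (fun i j iU jU => introT forall_inP (U1 i j iU jU))).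
  move=> /(_ (fun i j h => U2 i j (elimT forall_inP h))).
  apply: good_sub => [||i j /andP[/forall_inP a b]]; last 2 first.
  + exact: eqS.
  + by apply/forall_inP => v; rewrite !inE => /orP[/eqP->|/a].
  have [[r1 s1 t1] [r2 s2 t2]] := (eqS S, stable_sep_eqr w).
  split=> [i|i j|j i k]; first by rewrite r1 r2.
    by rewrite s1 s2.
  by move=> /andP[a b] /andP[a' b']; rewrite (t1 _ _ _ a a') (t2 _ _ _ b b').
Qed.

End Separation.

(** * Separation under contraction *)

Section Contraction.
Variables (n : nat) (G G' : tree_data n) (pi : 'I_(nint G) -> 'I_(nint G')).
Hypothesis ctr : contracts G G' pi.

Lemma fiber_avoid w x y : pi x = pi y -> pi x != pi w ->
  connect (avoid (adj G) w) x y.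
Proof.
case: ctr => _ /(_ x y) H _ _ /H {H} /connectP[p + ->].
elim: p x => //= a p IH x /andP[/andP[xa /eqP E] pp] xw.
apply: (@connect_trans _ _ a); last by apply: IH; rewrite -?E.
apply: connect1; rewrite /avoid xa andbT.
by apply/andP; split; [move: xw|move: xw; rewrite E]; apply: contraNneq => ->.
Qed.

(** Each edge of a path avoiding [pi w] lifts to an edge, and consecutive lifts are joined inside
    connected fibres, none of which contains [w]. *)
Lemma sep_contract w i j : sep (pi w) i j -> sep w i j.
Proof.
case: (ctr) => _ _ attE adjE; rewrite !sepE !attE => /orP[->//|/andP[iw cij]].
apply/orP; right; apply/andP; split; first by apply: contraNneq iw => ->.
case/connectP: cij => p; move: (att G i) iw => x xw; move Ex': (pi x) => x'.
elim: p x x' xw Ex' => [|a p IH] x x' xw xE /=.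
  by move=> _ E; apply: fiber_avoid; rewrite // E.
case/andP => /and3P[_ aw]; rewrite adjE => /andP[_].
case/existsP => x1 /existsP[y1 /and3P[/eqP x1E /eqP y1E e1]] pp pl.
apply: (@connect_trans _ _ x1); first by apply: fiber_avoid; rewrite // xE x1E.
apply: (@connect_trans _ _ y1); last by apply: IH pp pl; rewrite // y1E.
apply: connect1; rewrite /avoid e1 andbT; apply/andP; split.
  by move: xw; rewrite xE -x1E; apply: contraNneq => ->.
by move: aw; rewrite -y1E; apply: contraNneq => ->.
Qed.

(* A vertex on the simple path between two leaves separates them. *)
Lemma sep_expand v i j : is_stable_tree G ->
  (forall w, pi w = v -> sep w i j) -> sep v i j.
Proof.
move=> st Hsep; rewrite sepE; have [//|ij] := eqVneq i j.
case: (ctr) => _ _ attE adjE; rewrite /= !attE.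
have [_ [adjs _] adjc _ _] := st.
have /connectP[p0 p0p] := adjc (att G i) (att G j).
case/shortenP: p0p => p pp up _ lp.
have nov z : z \in att G i :: p -> pi z != v.
  apply: contraTneq => zv; apply/negP => zp.
  have := Hsep _ zv; rewrite sepE (negPf ij) => /andP[iz cij].
  move: zp; rewrite inE eq_sym (negPf iz) /= => zp.
  have jz := connect_avoid_neq cij iz.
  case/splitPr: zp pp up lp => p1 [|y p2].
    by rewrite last_cat /= => _ _ E; rewrite E eqxx in jz.
  rewrite cat_path -cat_cons cat_uniq last_cat /=.
  case/andP=> pp1 /and3P[exz ezy pp2] /and3P[_ up1 /andP[zp2 _]] lp.
  have zp1 : z \notin att G i :: p1.
    by apply: contraNN up1 => ->.
  have yp1 : y \notin att G i :: p1.
    by apply: contraNN up1 => ->; rewrite orbT.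
  (* [x] and [y] are the neighbours of [z] on the simple path. If the two leaves were joined away
     from [z], both would be children of [z] in one branch, hence equal. *)
  set x := last (att G i) p1 in exz.
  have [par [d rt]] := stable_rooted st z.
  have [xz px] : x != z /\ par x = z.
    by move: exz; rewrite adjs (rooted_adj_root rt) => /andP[-> /eqP].
  have cxy : connect (avoid (adj G) z) x y.
    apply: (@connect_trans _ _ (att G i)).
      by rewrite (sym_connect_sym (avoid_sym rt z)); apply: path_avoid.
    apply: connect_trans cij _.
    by rewrite (sym_connect_sym (avoid_sym rt z)) lp; apply: path_avoid.
  have := avoid_below rt xz; rewrite px => /(_ _ _ cxy (connect0 _ _)) yx.
  have yNx : y != x by apply: contraNneq yp1 => ->; apply: mem_last.
  have [_] := anc_strict rt yx yNx.
  move: ezy; rewrite (rooted_adj_root rt) => /andP[_ /eqP->] /(anc_r rt) E.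
  by rewrite E eqxx in xz.
rewrite nov ?mem_head //= lp.
elim: p (att G i) pp nov {up lp} => //= a p IH x /andP[xa pp] nov.
apply: (@connect_trans _ _ (pi a)); last first.
  by apply: IH => // z zp; apply: nov; rewrite inE zp orbT.
have [->|xNa] := eqVneq (pi x) (pi a); first exact: connect0.
apply: connect1; rewrite /avoid !nov ?inE ?eqxx ?orbT //= adjE xNa.
by apply/existsP; exists x; apply/existsP; exists a; rewrite !eqxx.
Qed.

Lemma fiber_connected c u : pi u = pi c ->
  connect (restr [set w | pi w == pi c]) u c.
Proof.
case: ctr => _ /(_ u c) H _ _ E; have /connectP[p + pc] := H E.
elim: p u E pc {H} => [|a p IH] u E /= pc; first by rewrite pc.
case/andP => /andP[ua /eqP ua'] pp; apply: (@connect_trans _ _ a).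
  by apply: connect1; rewrite /restr !inE ua -ua' E eqxx.
by apply: IH; rewrite // -ua'.
Qed.

End Contraction.

(** * Trees of laminar families *)

Section Laminar.
Variable n : nat.
Implicit Types (F : {set {set 'I_n}}) (X Y S : {set 'I_n}).

Definition laminar F : Prop := forall X Y, X \in F -> Y \in F ->
  X :&: Y != set0 -> X \subset Y \/ Y \subset X.

Definition fam F : {set {set 'I_n}} := [set: 'I_n] |: F.

Lemma fam_setT F : [set: 'I_n] \in fam F. Proof. exact: setU11. Qed.

Definition hull F S : {set 'I_n} :=
  [arg min_(Y < [set: 'I_n] | (Y \in fam F) && (S \subset Y)) #|Y|].

(** The full set is sent to itself, matching the convention that the root is its own parent. *)
Definition up F X : {set 'I_n} :=
  if X == [set: 'I_n] then [set: 'I_n] else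
  [arg min_(Y < [set: 'I_n] | (Y \in fam F) && (X \proper Y)) #|Y|].

Lemma laminar_fam F : laminar F -> laminar (fam F).
Proof.
move=> lF X Y; rewrite !inE => /orP[/eqP-> _|XF].
  by right; apply: subsetT.
by case/orP => [/eqP-> _|YF]; [left; apply: subsetT | apply: lF].
Qed.

(** Members with a common leaf are nested, so size decides the inclusion; this is why [hull] and
    [up], chosen of minimal size, are least for inclusion. *)
Lemma laminar_card F X Y i : laminar F -> X \in fam F -> Y \in fam F ->
  i \in X -> i \in Y -> #|X| <= #|Y| -> X \subset Y.
Proof.
move=> /laminar_fam lF XF YF iX iY cXY.
case: (lF X Y XF YF) => // [|YX]; first by apply/set0Pn; exists i; rewrite inE iX.
by have/eqP-> : Y == X by rewrite eqEcard YX.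
Qed.

Lemma hullP F S : laminar F -> S != set0 ->
  [/\ hull F S \in fam F, S \subset hull F S
    & forall Y, Y \in fam F -> S \subset Y -> hull F S \subset Y].
Proof.
move=> lF /set0Pn[i iS]; rewrite /hull.
case: arg_minnP => [|Z /andP[ZF SZ] minZ]; first by rewrite fam_setT subsetT.
split=> // Y YF SY; apply: (laminar_card lF ZF YF (subsetP SZ _ iS) (subsetP SY _ iS)).
by apply: minZ; rewrite YF.
Qed.

Lemma upP F X : laminar F -> X != set0 -> X != [set: 'I_n] ->
  [/\ up F X \in fam F, X \proper up F X
    & forall Y, Y \in fam F -> X \proper Y -> up F X \subset Y].
Proof.
move=> lF /set0Pn[i iX] XT; rewrite /up (negPf XT).
case: arg_minnP => [|Z /andP[ZF XZ] minZ]; first by rewrite fam_setT properT.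
split=> // Y YF XY; have [sXZ sXY] := (proper_sub XZ, proper_sub XY).
apply: (laminar_card lF ZF YF (subsetP sXZ _ iX) (subsetP sXY _ iX)).
by apply: minZ; rewrite YF.
Qed.

(* The tree whose vertices are the members of [fam F], each joined to the
   least member strictly containing it. *)
Definition lam_adj F X Y : bool :=
  (X != [set: 'I_n]) && (Y == up F X) || (Y != [set: 'I_n]) && (X == up F Y).

Definition lam_idx F X : 'I_#|fam F| := enum_rank_in (fam_setT F) X.

Definition lam_tree F : tree_data n :=
  @TreeData n #|fam F| (fun u w => lam_adj F (enum_val u) (enum_val w))
    (fun i => lam_idx F (hull F [set i])).

Definition lam_set F (u : 'I_(nint (lam_tree F))) : {set 'I_n} :=
  @enum_val _ (mem (fam F)) u.

Definition lam_vertex F X : 'I_(nint (lam_tree F)) := lam_idx F X.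

Lemma lam_setK F u : lam_vertex F (lam_set u) = u.
Proof. exact: enum_valK_in. Qed.

Lemma lam_vertexK F X : X \in fam F -> lam_set (lam_vertex F X) = X.
Proof. exact: enum_rankK_in. Qed.

Lemma lam_set_fam F (u : 'I_(nint (lam_tree F))) : lam_set u \in fam F.
Proof. exact: enum_valP. Qed.

Lemma lam_set_inj F : injective (@lam_set F).
Proof. exact: enum_val_inj. Qed.

Lemma lam_adjE F u w : adj (lam_tree F) u w = lam_adj F (lam_set u) (lam_set w).
Proof. by []. Qed.

Lemma lam_attE F i : att (lam_tree F) i = lam_vertex F (hull F [set i]).
Proof. by []. Qed.

Section LaminarTree.
Variable F : {set {set 'I_n}}.
Hypothesis lF : laminar F.
Hypothesis F_gt1 : forall X, X \in fam F -> 1 < #|X|.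

Let n0 X : X \in fam F -> X != set0.
Proof. by move/F_gt1; apply: contraTneq => ->; rewrite cards0. Qed.

Definition lam_root : 'I_(nint (lam_tree F)) := lam_vertex F [set: 'I_n].
Definition lam_par (u : 'I_(nint (lam_tree F))) := lam_vertex F (up F (lam_set u)).
Definition lam_depth (u : 'I_(nint (lam_tree F))) := n - #|lam_set u|.

Lemma lam_set_root : lam_set lam_root = [set: 'I_n].
Proof. exact: lam_vertexK (fam_setT F). Qed.

Lemma lam_rootE u : (u == lam_root) = (lam_set u == [set: 'I_n]).
Proof. by rewrite -lam_set_root (inj_eq (@lam_set_inj F)). Qed.

Lemma lam_set_par u : u != lam_root -> lam_set (lam_par u) = up F (lam_set u).
Proof.
rewrite lam_rootE => uT; apply: lam_vertexK.
by case: (upP lF (n0 (lam_set_fam u)) uT).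
Qed.

Lemma lam_rooted : rooted (adj (lam_tree F)) lam_root lam_par lam_depth.
Proof.
split=> [|u uT|u w].
- by apply: lam_set_inj; rewrite /lam_par lam_set_root /up eqxx lam_vertexK ?fam_setT.
- rewrite /lam_depth lam_set_par //; rewrite lam_rootE in uT.
  have [_ /proper_card lt _] := upP lF (n0 (lam_set_fam u)) uT.
  have : #|up F (lam_set u)| <= n by rewrite -[X in _ <= X](card_ord n) max_card.
  by lia.
- rewrite lam_adjE /lam_adj !lam_rootE; congr (_ || _).
    case: eqP => //= /eqP uT; rewrite -lam_set_par ?lam_rootE //.
    by rewrite (inj_eq (@lam_set_inj F)).
  case: eqP => //= /eqP uT; rewrite -lam_set_par ?lam_rootE //.
  by rewrite (inj_eq (@lam_set_inj F)).
Qed.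

Lemma lam_anc u w : fconnect lam_par u w = (lam_set u \subset lam_set w).
Proof.
apply/idP/idP => [/connectP[p + ->]|].
  elim: p u => //= a p IH u /andP[/eqP <- pp]; apply: subset_trans (IH _ pp).
  have [->|ur] := eqVneq u lam_root; first by case: lam_rooted => -> _ _.
  rewrite lam_set_par //; rewrite lam_rootE in ur.
  by have [_ /proper_sub] := upP lF (n0 (lam_set_fam u)) ur.
elim: {u}_.+1 {-2}u (ltnSn (lam_depth u)) => // m IH u; rewrite ltnS => du uw.
have [/lam_set_inj->|uNw] := eqVneq (lam_set u) (lam_set w); first exact: connect0.
have puw : lam_set u \proper lam_set w by rewrite properEneq uNw.
have ur : u != lam_root.
  by rewrite lam_rootE; apply: contraTneq puw => ->; rewrite /proper subsetT andbF.
apply: connect_trans (fconnect1 _ _) _; apply: IH.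
  by case: lam_rooted => _ /(_ u ur) lt _; apply: leq_trans lt du.
rewrite lam_set_par //; rewrite lam_rootE in ur.
by have [_ _] := upP lF (n0 (lam_set_fam u)) ur; apply => //; apply: lam_set_fam.
Qed.

(** A leaf hangs at the least member containing it, and ancestry is inclusion by [lam_anc]. *)
Lemma lam_below u : below lam_par u = lam_set u.
Proof.
apply/setP => i; rewrite inE lam_anc lam_attE.
have [hF ih hmin] : [/\ hull F [set i] \in fam F, [set i] \subset hull F [set i]
    & forall Y, Y \in fam F -> [set i] \subset Y -> hull F [set i] \subset Y].
  by apply: hullP => //; apply/set0Pn; exists i; rewrite set11.
rewrite lam_vertexK //; apply/idP/idP => [/subsetP/(_ i)|iu].
  by apply; rewrite -sub1set.
by apply: hmin; rewrite ?sub1set ?lam_set_fam.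
Qed.

Lemma lam_sep_root i j : sep lam_root i j =
  (i == j) || [exists Y in F, [&& Y != [set: 'I_n], i \in Y & j \in Y]].
Proof.
rewrite (sep_root lam_rooted); congr (_ || _); apply/existsP/existsP.
  case=> z; rewrite !lam_below lam_rootE => /andP[zT h]; exists (lam_set z).
  by have := lam_set_fam z; rewrite zT h !inE (negPf zT) => /= ->.
case=> Y /and3P[YF YT h]; exists (lam_vertex F Y).
by rewrite !lam_below lam_rootE lam_vertexK ?YT // inE YF orbT.
Qed.

Lemma lam_sep_out (u : 'I_(nint (lam_tree F))) i j :
  i \notin lam_set u -> j \notin lam_set u -> sep u i j.
Proof. by rewrite -!lam_below; apply: (sep_out lam_rooted). Qed.

Lemma lam_sep_in (u : 'I_(nint (lam_tree F))) Y i j : Y \in F -> Y \proper lam_set u ->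
  i \in Y -> j \in Y -> sep u i j.
Proof.
move=> YF pY iY jY; have YfF : Y \in fam F by rewrite inE YF orbT.
apply: (sep_in lam_rooted (y := lam_vertex F Y)).
- by rewrite lam_below lam_vertexK.
- by rewrite lam_below lam_vertexK.
- by rewrite lam_anc lam_vertexK //; apply: proper_subn.
Qed.

Lemma lam_stable i j k :
  ~~ sep lam_root i j -> ~~ sep lam_root j k -> ~~ sep lam_root k i ->
  is_stable_tree (lam_tree F).
Proof.
move=> ij jk ki; apply: (rooted_stable lam_rooted).
- by move=> u; rewrite lam_below F_gt1 ?lam_set_fam.
- move=> u ur; rewrite !lam_below lam_set_par //; rewrite lam_rootE in ur.
  have [_ + _] := upP lF (n0 (lam_set_fam u)) ur.
  by rewrite properEneq => /andP[].
- by exists i, j, k.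
Qed.

End LaminarTree.

(** * Contraction onto a family of leaf sets of a tree *)

Section ContractLaminar.
Variables (G : tree_data n) (r : 'I_(nint G)) (par : 'I_(nint G) -> 'I_(nint G)).
Variable d : 'I_(nint G) -> nat.
Hypothesis rt : rooted (adj G) r par d.
Hypothesis st : is_stable_tree G.
Variable F : {set {set 'I_n}}.
Hypothesis F_below : forall Y, Y \in F -> exists x, Y = below par x.

Notation anc := (fconnect par).
Notation bel := (below par).

Let below_exists Y : Y \in fam F -> exists x, Y = bel x.
Proof.
by rewrite !inE => /orP[/eqP->|/F_below//]; exists r; rewrite (below_root rt).
Qed.

Let ancE x y : (bel x \subset bel y) = anc x y.
Proof. by apply/idP/idP; [exact: (below_anc rt st) | exact: belowS]. Qed.

Lemma below_laminar : laminar F.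
Proof.
move=> X Y /F_below[x ->] /F_below[y ->] /set0Pn[i]; rewrite !inE => /andP[ix iy].
by rewrite !ancE; apply: anc_chain ix iy.
Qed.

Definition lam_proj x : 'I_(nint (lam_tree F)) := lam_vertex F (hull F (bel x)).

Let hl x := hull F (bel x).

Let hlP x : [/\ hl x \in fam F, bel x \subset hl x
    & forall Y, Y \in fam F -> bel x \subset Y -> hl x \subset Y].
Proof.
apply: (hullP below_laminar); rewrite -card_gt0.
exact: ltnW (below_gt1 rt st x).
Qed.

Lemma lam_set_proj x : lam_set (lam_proj x) = hl x.
Proof. by apply: lam_vertexK; case: (hlP x). Qed.

Let hl_mono x y : anc x y -> hl x \subset hl y.
Proof.
rewrite -ancE => xy; have [[_ _ h] [yF ys _]] := (hlP x, hlP y).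
by apply: h => //; apply: subset_trans ys.
Qed.

Let hl_below y : bel y \in fam F -> hl y = bel y.
Proof.
move=> yF; have [_ s h] := hlP y; apply/eqP; rewrite eqEsubset s andbT.
exact: h.
Qed.

(** Passing from [x] to its parent changes the hull only when the leaf set of [x] is itself a
    member; the parent then falls to the next larger member. *)
Let hl_par x : x != r -> hl x != hl (par x) ->
  [/\ bel x = hl x, hl x != [set: 'I_n] & hl (par x) = up F (hl x)].
Proof.
move=> xr neq; have [xF xs xmin] := hlP x; have [pF ps pmin] := hlP (par x).
have [y yE] := below_exists xF.
have xpx : anc x (par x) := anc_par _ _.
have xy : anc x y by rewrite -ancE -yE.
have sub := hl_mono xpx.
have bx : bel x = hl x.
  rewrite yE; have [->//|xNy] := eqVneq x y; exfalso; case/negP: neq.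
  rewrite eqEsubset sub; apply: pmin => //; rewrite yE ancE.
  by case: (anc_strict rt xy xNy).
have xT : hl x != [set: 'I_n].
  by apply: contraNneq neq => E; move: sub; rewrite E subTset eq_sym.
split=> //; have x0 : hl x != set0.
  by rewrite -bx -card_gt0; apply: ltnW (below_gt1 rt st x).
have [uF up_pr umin] := upP below_laminar x0 xT.
apply/eqP; rewrite eqEsubset umin ?properEneq ?neq ?sub // andbT.
have [z zE] := below_exists uF; apply: pmin => //; rewrite zE ancE.
have xz : bel x \proper bel z by rewrite -zE bx.
have xNz : x != z by apply: contraTneq xz => ->; rewrite properxx.
by have := proper_sub xz; rewrite ancE => /(anc_strict rt)/(_ xNz)[].
Qed.

Let up_exists Y : Y \in fam F -> Y != [set: 'I_n] ->
  exists x, [/\ x != r, hl x = Y, hl (par x) = up F Y & Y != up F Y].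
Proof.
move=> YF YT; have [x xE] := below_exists YF; exists x.
have xr : x != r by apply: contraNneq YT => E; rewrite xE E (below_root rt).
have hx : hl x = Y by rewrite xE hl_below // -xE.
have neq : hl x != hl (par x).
  apply: contraNneq (par_neq rt xr) => E; apply/eqP/(anc_anti rt); last exact: anc_par.
  have [_ s _] := hlP (par x); rewrite -ancE -xE -hx E.
  exact: s.
have [_ _ pE] := hl_par xr neq.
by rewrite -{3}hx pE hx in neq *.
Qed.

Lemma lam_proj_root : lam_proj r = lam_root F.
Proof.
apply/eqP; rewrite lam_rootE lam_set_proj; have [_ + _] := hlP r.
by rewrite (below_root rt) subTset.
Qed.

Lemma lam_proj_eq_root x Y : lam_proj x = lam_root F -> Y \in F -> bel x \subset Y ->
  Y = [set: 'I_n].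
Proof.
move=> /eqP; rewrite lam_rootE lam_set_proj => /eqP E YF xY.
have [_ _ h] := hlP x; have := h Y; rewrite inE YF orbT => /(_ isT xY).
by rewrite E subTset => /eqP.
Qed.

Lemma contracts_lam_tree : contracts G (lam_tree F) lam_proj.
Proof.
have projE x u : (lam_proj x == u) = (hl x == lam_set u).
  by rewrite -lam_set_proj (inj_eq (@lam_set_inj F)).
(* Every vertex climbs, without leaving its fibre, to the vertex whose leaf set is its hull; so
   fibres are connected. *)
have climb x y : bel y = hl x ->
    connect (fun a b => adj G a b && (lam_proj a == lam_proj b)) x y.
  elim: {x}_.+1 {-2}x (ltnSn (d x)) => // m IH x; rewrite ltnS => dx yE.
  have [xF xs xmin] := hlP x.
  have xy : anc x y by rewrite -ancE yE.
  have [->|xNy] := eqVneq x y; first exact: connect0.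
  have [xr py] := anc_strict rt xy xNy.
  have pE : hl (par x) = hl x.
    apply/eqP; rewrite eqEsubset (hl_mono (anc_par par x)) andbT.
    by have [_ _ h] := hlP (par x); apply: h; rewrite // -yE ancE.
  apply: (@connect_trans _ _ (par x)).
    by apply: connect1; rewrite (rooted_par rt xr) projE lam_set_proj pE eqxx.
  apply: IH; last by rewrite pE.
  by case: rt => _ /(_ x xr) lt _; apply: leq_trans lt dx.
split.
- move=> u; have [x xE] := below_exists (lam_set_fam u); exists x.
  by apply/eqP; rewrite projE hl_below -?xE ?lam_set_fam.
- move=> x y /eqP; rewrite projE lam_set_proj => /eqP E.
  have [z zE] : exists z, hl x = bel z by apply: below_exists; case: (hlP x).
  apply: (@connect_trans _ _ z); first exact: climb.
  rewrite sym_connect_sym; first by apply: climb; rewrite -E.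
  by move=> a b; rewrite (rooted_sym rt) [lam_proj a == _]eq_sym.
- move=> i; rewrite lam_attE /lam_proj; congr lam_vertex.
  have [hF ih hmin] : [/\ hull F [set i] \in fam F, [set i] \subset hull F [set i]
      & forall Y, Y \in fam F -> [set i] \subset Y -> hull F [set i] \subset Y].
    by apply: (hullP below_laminar); apply/set0Pn; exists i; rewrite set11.
  have [aF as_ amin] := hlP (att G i).
  apply/eqP; rewrite eqEsubset hmin //=; last first.
    by rewrite sub1set; apply: (subsetP as_); rewrite inE connect0.
  apply: amin => //; move: ih; have [z ->] := below_exists hF.
  by rewrite sub1set ancE inE.
- move=> u w; have uF := lam_set_fam u; have wF := lam_set_fam w.
  rewrite lam_adjE /lam_adj -(inj_eq (@lam_set_inj F)).
  apply/idP/andP => [|[uw /existsP[x /existsP[y]]]].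
    case/orP => /andP[XT /eqP E].
      have [x [xr hx px neq]] := up_exists uF XT; split; first by rewrite E.
      apply/existsP; exists x; apply/existsP; exists (par x).
      by rewrite !projE hx px E !eqxx (rooted_par rt).
    have [x [xr hx px neq]] := up_exists wF XT; split; first by rewrite E eq_sym.
    apply/existsP; exists (par x); apply/existsP; exists x.
    by rewrite !projE hx px E !eqxx (rooted_sym rt) (rooted_par rt).
  rewrite !projE => /and3P[/eqP xu /eqP yw]; rewrite (rooted_adj rt).
  case/orP => /andP[r1 /eqP yE]; apply/orP; [left|right].
    have [] := hl_par r1; first by rewrite -yE xu yw.
    by rewrite -yE xu yw => _ -> ->; rewrite eqxx.
  have [] := hl_par r1; first by rewrite -yE xu yw eq_sym.
  by rewrite -yE xu yw => _ -> ->; rewrite eqxx.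
Qed.

End ContractLaminar.
End Laminar.

(** * Atomic extremal assignments *)

Section BigClasses.
Variable n : nat.
Implicit Types (e : rel 'I_n) (B : {set 'I_n}).

(** Singleton blocks are leaves attached directly to the centre and must not become internal
    vertices. *)
Definition big_eclasses e : {set {set 'I_n}} := [set B in eclasses e | 1 < #|B|].

Lemma eq_big_eclasses e e' : e =2 e' -> big_eclasses e = big_eclasses e'.
Proof.
move=> ee; rewrite /big_eclasses; suff -> : eclasses e = eclasses e' by [].
by apply: eq_imset => x; apply/setP => y; rewrite !inE ee.
Qed.

Lemma eclass_of_mem e B i : eqr e -> B \in eclasses e -> i \in B -> B = eclass e i.
Proof.
by move=> eqe /imsetP[x _ ->]; rewrite inE => xi; apply/eqP; rewrite eq_eclass.
Qed.

Lemma big_eclass e i j : eqr e -> i != j -> e i j -> eclass e i \in big_eclasses e.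
Proof.
move=> [er _ _] ij eij; rewrite inE imset_f //=.
by apply/card_gt1P; exists i, j; rewrite !inE er.
Qed.

Lemma laminar_big_eclasses e e0 : eqr e -> eqr e0 -> (forall i j, e0 i j -> e i j) ->
  laminar (big_eclasses e :|: big_eclasses e0).
Proof.
move=> eqe eq0 sub X Y XF YF /set0Pn[i]; rewrite inE => /andP[iX iY].
have cls B : B \in big_eclasses e :|: big_eclasses e0 -> i \in B ->
    B = eclass e i \/ B = eclass e0 i.
  rewrite !inE => /orP[] /andP[Bc _] iB; [left|right]; exact: eclass_of_mem iB.
have s0 : eclass e0 i \subset eclass e i.
  by apply/subsetP => j; rewrite !inE; apply: sub.
by case: (cls X XF iX) (cls Y YF iY) => -> [] ->; rewrite ?subxx ?s0; auto.
Qed.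

Lemma fam_big_gt1 (F : {set {set 'I_n}}) : 1 < n ->
  (forall X, X \in F -> 1 < #|X|) -> forall X, X \in fam F -> 1 < #|X|.
Proof.
by move=> n1 F1 X; rewrite inE => /orP[/set1P->|/F1//]; rewrite cardsT card_ord.
Qed.

(* The tree with root partition [e], whose blocks are subdivided by [e0]. *)
Lemma refined_star e e0 i j k : eqr e -> eqr e0 -> (forall i j, e0 i j -> e i j) ->
  1 < n -> ~~ e i j -> ~~ e j k -> ~~ e k i ->
  let F := big_eclasses e :|: big_eclasses e0 in
  [/\ laminar F, forall X, X \in fam F -> 1 < #|X|,
      sep (lam_root F) =2 e & is_stable_tree (lam_tree F)].
Proof.
move=> eqe eq0 sub n1 eij ejk eki F.
have [er es et] := eqe.
have lF : laminar F by apply: laminar_big_eclasses.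
have F1 X : X \in fam F -> 1 < #|X|.
  by apply: fam_big_gt1 => // {}X; rewrite !inE => /orP[] /andP[].
have sepF : sep (lam_root F) =2 e.
  move=> a b; rewrite (lam_sep_root lF F1); apply/orP/idP.
    case=> [/eqP->|/exists_inP[Y YF /and3P[_ aY bY]]]; first exact: er.
    move: YF; rewrite !inE => /orP[] /andP[Yc _].
      by move: bY; rewrite (eclass_of_mem eqe Yc aY) inE.
    by apply: sub; move: bY; rewrite (eclass_of_mem eq0 Yc aY) inE.
  have [->|ab eab] := eqVneq a b; first by left.
  right; apply/exists_inP; exists (eclass e a).
    by rewrite inE (big_eclass eqe ab).
  (* [i] and [j] are not related by [e], so no class is the full set. *)
  rewrite !inE er eab !andbT; apply: contraNneq eij => /setP E.
  by have := E i; have := E j; rewrite !inE => aj ai; apply: (et a) => //; rewrite es.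
split=> //; apply: (@lam_stable _ F lF F1 i j k); by rewrite sepF.
Qed.

End BigClasses.

Section ExtremalSeparation.
Variables (n : nat) (Z : assignment n).
Hypothesis Zext : extremal Z.

Lemma stable_gt1 (H : tree_data n) : is_stable_tree H -> 1 < n.
Proof.
move=> st; have [n0 _ _ _ _] := st; have [par [d rt]] := stable_rooted st (Ordinal n0).
by rewrite -(card_ord n) (leq_trans (below_gt1 rt st (Ordinal n0))) // max_card.
Qed.

Lemma star_stable (H : tree_data n) (w : 'I_(nint H)) : is_stable_tree H ->
  let F := big_eclasses (sep w) in
  [/\ laminar F, forall X, X \in fam F -> 1 < #|X|,
      sep (lam_root F) =2 sep w & is_stable_tree (lam_tree F)].
Proof.
move=> st F; have [i [j [k [ij jk ki]]]] := three_separated st w.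
have eqw := stable_sep_eqr st w.
have := refined_star eqw eqw (fun _ _ => id) (stable_gt1 st) ij jk ki.
by rewrite setUid.
Qed.

(* Collapsing every branch at [w] to a point leaves the star of [sep w]. *)
Lemma extremal_star (H : tree_data n) (w : 'I_(nint H)) : is_stable_tree H ->
  (w \in Z H) = (lam_root (big_eclasses (sep w)) \in Z (lam_tree (big_eclasses (sep w)))).
Proof.
move=> st; have [lF F1 _ stF] := star_stable w st; set F := big_eclasses _ in lF F1 stF *.
have [par [d rt]] := stable_rooted st w.
have eqw := stable_sep_eqr st w.
have F_below Y : Y \in F -> exists x, Y = below par x.
  rewrite inE => /andP[Yc /card_gt1P[i [j [iY jY ij]]]].
  have YE := eclass_of_mem eqw Yc iY; rewrite YE in jY.
  move: jY; rewrite inE (sep_root rt) (negPf ij) => /existsP[z /and3P[zw iz _]].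
  have [c [cw pc zc]] := child_towards rt (anc_root rt z) zw.
  by exists c; rewrite YE (eclass_sep_root rt cw pc (subsetP (belowS zc) _ iz)).
have [_ /(_ H _ _ st stF (contracts_lam_tree rt st F_below)) ->] := Zext.
(* The fibre over the root is [w] alone: any other vertex lies below a child of [w], whose leaf set
   is a member of [F]. *)
apply/idP/forall_inP => [wZ x|]; last first.
  by apply; rewrite (lam_proj_root rt st F_below).
have [->//|xw] := eqVneq x w; move=> /eqP px.
have [c [cw pc xc]] := child_towards rt (anc_root rt x) xw.
have cF : below par c \in F.
  have c1 := below_gt1 rt st c; have /card_gt0P[i ic] := ltnW c1.
  by rewrite inE c1 andbT -(eclass_sep_root rt cw pc ic) imset_f.
have := lam_proj_eq_root rt st F_below px cF (belowS xc).
rewrite -(below_root rt) => cE; have : below par w \subset below par c by rewrite cE.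
by move=> /(below_anc rt st)/(anc_r rt) E; rewrite E eqxx in cw.
Qed.

Lemma extremal_sep_eq (H H' : tree_data n) (w : 'I_(nint H)) (w' : 'I_(nint H')) :
  is_stable_tree H -> is_stable_tree H' -> sep w =2 sep w' ->
  (w \in Z H) = (w' \in Z H').
Proof.
by move=> st st' /eq_big_eclasses E; rewrite extremal_star // E -extremal_star.
Qed.

(** In the refined star the root separates like [w]. Contracting it onto the blocks of [sep v] gives
    a star whose root separates like [v], and assignment passes from that root to its whole
    fibre. *)
Lemma extremal_sep_sub (H0 H : tree_data n) (v : 'I_(nint H0)) (w : 'I_(nint H)) :
  is_stable_tree H0 -> is_stable_tree H -> (forall i j, sep v i j -> sep w i j) ->
  v \in Z H0 -> w \in Z H.
Proof.
move=> st0 st sub; rewrite extremal_star //; set F0 := big_eclasses _ => vZ.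
have [i [j [k [ij jk ki]]]] := three_separated st w.
have [eq0 eqw] := (stable_sep_eqr st0 v, stable_sep_eqr st w).
have [lF F1 sepF stF] := refined_star eqw eq0 sub (stable_gt1 st) ij jk ki.
set F := _ :|: _ in lF F1 sepF stF.
rewrite -(extremal_sep_eq stF st sepF).
have [_ _ _ stF0] := star_stable v st0.
have rt := lam_rooted lF F1.
have F_below Y : Y \in F0 -> exists x, Y = below (@lam_par _ F) x.
  move=> YF; exists (lam_vertex F Y); rewrite (lam_below lF F1) lam_vertexK //.
  by apply/setU1P; right; apply/setUP; right.
have [_ /(_ _ _ _ stF stF0 (contracts_lam_tree rt stF F_below)) E] := Zext.
move: vZ; rewrite E => /forall_inP; apply.
by rewrite (lam_proj_root rt stF F_below).
Qed.

End ExtremalSeparation.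

Section Basic.
Variables (n : nat) (G : tree_data n) (v : 'I_(nint G)).
Hypothesis vG : is_basic_pair v.

(** The second internal vertex of a basic pair has at least two leaves below it. *)
Lemma basic_nondiscrete : exists i j, i != j /\ sep v i j.
Proof.
have [st [n2 _]] := vG; have [par [d rt]] := stable_rooted st v.
have /card_gt0P[u] : 0 < #|[set~ v]| by rewrite cardsC1 card_ord; lia.
rewrite !inE => uv; have /card_gt1P[i [j [iu ju ij]]] := below_gt1 rt st u.
by exists i, j; split=> //; rewrite (sep_root rt); apply/orP; right; apply/existsP;
  exists u; rewrite uv iu ju.
Qed.

Lemma mem_atomic (Z : assignment n) (H : tree_data n) (w : 'I_(nint H)) :
  is_atomic v Z -> is_stable_tree H ->
  w \in Z H <-> (forall i j, sep v i j -> sep w i j).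
Proof.
move=> [Zext vZ Zmin] st; have [stG _] := vG; split=> [wZ|sub]; last first.
  exact: extremal_sep_sub sub vZ.
(* Once [Z'] is known to be extremal, minimality of the atomic assignment puts [Z H] inside it. *)
pose Z' (K : tree_data n) : {set 'I_(nint K)} :=
  [set x | [forall i, forall j, sep v i j ==> sep x i j]].
have Z'P (K : tree_data n) (x : 'I_(nint K)) :
    reflect (forall i j, sep v i j -> sep x i j) (x \in Z' K).
  rewrite inE; apply: (iffP forallP) => [h i j|h i].
    by have /forallP/(_ j)/implyP := h i.
  by apply/forallP => j; apply/implyP; apply: h.
apply/Z'P; apply: (subsetP (Zmin Z' _ _ H st)) => //; last by apply/Z'P.
split=> [K stK|K K' pi stK stK' ctr x'].
  (* The vertex carrying [i] isolates [i], so it cannot join it to [j] and is not assigned. *)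
  have [i [j [ij sij]]] := basic_nondiscrete.
  apply: contraNneq ij => E.
  have /Z'P/(_ i j sij) : att K i \in Z' K by rewrite E inE.
  by rewrite sepE eqxx orbF.
apply/Z'P/forall_inP => [h x /eqP xE|h i j sij].
  by apply/Z'P => i j /h; rewrite -xE; apply: (sep_contract ctr).
apply: (sep_expand ctr stK) => x xE; have /Z'P := h x (introT eqP xE).
exact.
Qed.

End Basic.

Lemma relabel_stable n (s : 'S_n) (H : tree_data n) :
  is_stable_tree H -> is_stable_tree (relabel s H).
Proof.
case=> n0 symH conH cardH deg; split=> // w.
have := deg w; rewrite -[X in _ + X](card_preimset _ (@perm_inj _ s^-1)%g).
rewrite /=; congr (_ < _ + _).
by apply: eq_card => i; rewrite !inE.
Qed.

Lemma sep_relabel n (s : 'S_n) (H : tree_data n) (w : 'I_(nint H)) i j :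
  sep (w : 'I_(nint (relabel s H))) i j = sep w (s^-1 i)%g (s^-1 j)%g.
Proof. by rewrite !sepE /= (inj_eq perm_inj). Qed.

(** * Special families *)

(** This lemma and the next describe which indices are identified by [ref_by_merger] and
    [ref_by_mergel]. *)
Lemma minn_eq s x y : minn x s = minn y s -> if s <= x then s <= y else x == y.
Proof. by case: (leqP s x); lia. Qed.

Lemma subSn_eq s x y :
  x.+1 - s = y.+1 - s -> if s <= x then x == y else ~~ (s <= y).
Proof. by case: (leqP s x); lia. Qed.

(* [kept] and [added] are realised by the two vertices [root] and [U] of a
   tree whose contraction has the blocks [kept ++ added] around its root. *)
Lemma good_two_centers n (Z : assignment n) F kept added :
  extremal Z ->
  (forall (H : tree_data n) (w : 'I_(nint H)), is_stable_tree H ->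
     w \in Z H <-> good F (sep w)) ->
  1 < size kept -> 1 < size added -> positive_parts (kept ++ added) ->
  sumn (kept ++ added) = n ->
  (exists2 p, p \in F & part_le (kept ++ [:: sumn added]) p) ->
  (exists2 p, p \in F & part_le (sumn kept :: added) p) ->
  exists2 p, p \in F & part_le (kept ++ added) p.
Proof.
move=> Zext memZ k2 a2 pos sumE gd1 gd2.
have [a La] := lab_exists sumE; have [a_lt a_fib] := La.
have hit m : m < size kept + size added -> exists i, a i = m.
  rewrite -size_cat => ltm.
  have : 0 < #|[set x | a x == m]| by rewrite a_fib //; apply: (all_nthP 0 pos).
  by case/card_gt0P => i; rewrite inE => /eqP; exists i.
pose e i j := a i == a j.
(* [e1] merges all added blocks into one and [e2] all kept blocks; their intersection is [e]. *)
pose e1 i j := minn (a i) (size kept) == minn (a j) (size kept).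
pose e2 i j := (a i).+1 - size kept == (a j).+1 - size kept.
have eq_ker (f : 'I_n -> nat) : eqr (fun i j => f i == f j).
  by split=> [i|i j|j i k] => [||/eqP->//]; rewrite ?eqxx // eq_sym.
have [eqe eq1 eq2] : [/\ eqr e, eqr e1 & eqr e2] by split; apply: eq_ker.
(* Leaves of blocks 0, 1 and [size kept] will be pairwise separated at the root. The two added
   blocks show that [U] has at least two leaves and is larger than each block inside it. *)
have [[i ai] [j aj]] : (exists i, a i = 0) /\ exists j, a j = 1 by split; apply: hit; lia.
have [[k ak] [l al]] : (exists i, a i = size kept) /\ exists j, a j = (size kept).+1.
  by split; apply: hit; lia.
have [posk posa] : positive_parts kept /\ positive_parts added.
  by move: pos; rewrite positive_parts_cat => /andP.
have good_ker f q (e' : rel 'I_n) : ref_by f (kept ++ added) q -> positive_parts q ->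
    (forall x y, e' x y = (f (a x) == f (a y))) ->
    (exists2 p, p \in F & part_le q p) -> good F e'.
  move=> fq posq e'E [p Fp le]; exists p => //.
  have pq := lab_ipart posq (lab_ref_by La fq) e'E.
  apply: part_le_trans le; apply: part_le_perm => //.
  by rewrite (perm_positive pq).
have g1 : good F e1.
  apply: good_ker (ref_by_merger _ _) _ _ gd1 => //.
  by rewrite positive_parts_cat posk /= sumn_gt0 // ltnW.
have g2 : good F e2.
  apply: good_ker (ref_by_mergel _ _) _ _ gd2 => //.
  by rewrite /= sumn_gt0 // ltnW.
pose U : {set 'I_n} := [set x | size kept <= a x].
pose B := big_eclasses e.
have kl : k != l by apply: contraTneq isT => E; move: al; rewrite -E ak; lia.
have kU : k \in U by rewrite inE ak.
have lU : l \in U by rewrite inE al.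
have iU : i \notin U by rewrite inE ai; lia.
have n1 : 1 < n.
  by rewrite -(card_ord n); apply/card_gt1P; exists k, l.
have Bcls X x : X \in B -> x \in X -> X = eclass e x.
  by rewrite inE => /andP[Xc _]; apply: eclass_of_mem.
have BT X : X \in B -> X != [set: 'I_n].
  move=> XB; apply: contraTneq isT => XT.
  have := Bcls X i XB; rewrite XT inE => /(_ isT)/setP/(_ k).
  by rewrite !inE /e ai ak ltn_eqF // ltnW.
have lamB : laminar B by have := laminar_big_eclasses eqe eqe (fun _ _ => id); rewrite setUid.
have B1 X : X \in fam B -> 1 < #|X| by apply: fam_big_gt1 => // {}X; rewrite inE => /andP[].
have sub_or X x : X \in B -> x \in X -> x \in U -> X \subset U.
  move=> XB xX; rewrite (Bcls _ _ XB xX) inE => xU; apply/subsetP => y.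
  by rewrite !inE /e => /eqP <-.
(* Adding [U] to the blocks creates the second centre; dropping it again contracts the edge between
   the centres. *)
pose B' := U |: B.
have lamB' : laminar B'.
  have LU X : X \in B -> U :&: X != set0 -> X \subset U.
    by move=> XB /set0Pn[x]; rewrite inE => /andP[xU xX]; apply: sub_or xU.
  move=> X Y /setU1P[->|XB] /setU1P[->|YB]; first by left.
  - by right; apply: LU.
  - by rewrite setIC; left; apply: LU.
  - exact: lamB.
have B'1 X : X \in fam B' -> 1 < #|X|.
  apply: fam_big_gt1 => // {}X /setU1P[->|]; last by rewrite inE => /andP[].
  by apply/card_gt1P; exists k, l.
have sepB x y : sep (lam_root B) x y -> e x y.
  rewrite (lam_sep_root lamB B1) => /orP[/eqP->|]; first exact: eqxx.
  case/exists_inP => X XB /and3P[_ xX]; by rewrite (Bcls _ _ XB xX) inE.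
have sepB' x y : sep (lam_root B') x y -> e1 x y.
  rewrite (lam_sep_root lamB' B'1) => /orP[/eqP->|]; first exact: eqxx.
  case/exists_inP => X /setU1P[->|XB] /and3P[_ xX].
    by move: xX; rewrite !inE /e1 => /minn_idPr-> /minn_idPr->.
  by rewrite (Bcls _ _ XB xX) inE /e /e1 => /eqP->.
have sepBB' x y : sep (lam_root B) x y -> e1 x y.
  by move/sepB; rewrite /e /e1 => /eqP->.
have [Nij Njk Nki] : [/\ ~~ e1 i j, ~~ e1 j k & ~~ e1 k i].
  rewrite /e1 ai aj ak minnn min0n (minn_idPl (ltnW k2)); split=> //.
    by rewrite neq_ltn k2.
  by rewrite neq_ltn orbC ltnW.
have stB : is_stable_tree (lam_tree B).
  by apply: (@lam_stable _ B lamB B1 i j k); [move: Nij|move: Njk|move: Nki];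
    apply: contra; apply: sepBB'.
have stB' : is_stable_tree (lam_tree B').
  by apply: (@lam_stable _ B' lamB' B'1 i j k); [move: Nij|move: Njk|move: Nki];
    apply: contra; apply: sepB'.
have rt := lam_rooted lamB' B'1.
have F_below Y : Y \in B -> exists x, Y = below (@lam_par _ B') x.
  move=> YB; exists (lam_vertex B' Y); rewrite (lam_below lamB' B'1) lam_vertexK //.
  by rewrite !in_setU1 YB !orbT.
have UF : U \in fam B' by rewrite !in_setU1 eqxx orbT.
have eqs := stable_sep_eqr stB'.
have rootZ : lam_root B' \in Z (lam_tree B').
  apply/memZ => //; apply: good_sub (g1) => // x y exy.
  rewrite (lam_sep_root lamB' B'1); have [//|xy] := eqVneq x y.
  apply/exists_inP; case: (boolP (x \in U)) => xU.
    have yU : y \in U.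
      by move/eqP/minn_eq: exy; move: xU; rewrite !inE => ->.
    exists U; first by rewrite in_setU1 eqxx.
    by rewrite xU yU !andbT; apply: contraNneq iU => ->; rewrite inE.
  have eqxy : e x y.
    by move/eqP/minn_eq: exy; move: xU; rewrite inE => /negPf->.
  have XB := big_eclass eqe xy eqxy.
  exists (eclass e x); first by rewrite in_setU1 XB orbT.
  by rewrite BT //= !inE eqxy /e eqxx.
have UZ : lam_vertex B' U \in Z (lam_tree B').
  apply/memZ => //; apply: good_sub (g2) => // x y exy.
  have [->|xy] := eqVneq x y; first exact: connect0.
  case: (boolP (x \in U)) => xU; last first.
    apply: (lam_sep_out lamB' B'1); rewrite lam_vertexK //.
    by move/eqP/subSn_eq: exy; move: xU; rewrite !inE => /negPf->.
  have eqxy : e x y.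
    by move/eqP/subSn_eq: exy; move: xU; rewrite inE => ->.
  have XB := big_eclass eqe xy eqxy.
  have xX : x \in eclass e x by rewrite inE /e.
  apply: (lam_sep_in lamB' B'1 (Y := eclass e x)) => //; last by rewrite inE.
    by rewrite in_setU1 XB orbT.
  rewrite lam_vertexK // properE (sub_or _ _ XB xX xU) /=; apply/negP => sUX.
  have := subsetP sUX _ kU; have := subsetP sUX _ lU.
  by rewrite !inE /e al ak => /eqP-> /eqP/esym/n_Sn.
have rootZB : lam_root B \in Z (lam_tree B).
  have [_ /(_ _ _ _ stB' stB (contracts_lam_tree rt stB' F_below)) ->] := Zext.
  (* Only the root and [U] lie over the root, since a block in [B] is a vertex of its own. *)
  apply/forall_inP => x /eqP px; rewrite -(lam_setK x).
  have := lam_set_fam x; rewrite !in_setU1 => /or3P[/eqP->//|/eqP->//|xB].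
  have := lam_proj_eq_root rt stB' F_below px xB.
  rewrite (lam_below lamB' B'1) subxx => /(_ isT) E.
  by have := BT _ xB; rewrite E eqxx.
have [p Fp le] := good_sub (stable_sep_eqr stB _) eqe sepB (proj1 (memZ _ _ stB) rootZB).
exists p => //; apply: part_le_trans le; apply: part_le_perm => //.
by rewrite perm_sym; apply: (lab_ipart pos La).
Qed.

Lemma extremal_special n (Z : assignment n) F :
  extremal Z ->
  (forall (H : tree_data n) (w : 'I_(nint H)), is_stable_tree H ->
     w \in Z H <-> good F (sep w)) ->
  (forall p, p \in F -> exists2 e : rel 'I_n, eqr e & p = ipart e) ->
  special_family F.
Proof.
move=> Zext memZ Fe r; elim=> {r} [q ps Fps le|q r _ [pj Fpj le_q]]; first by exists ps.
case=> pt [Fpt [kept [removed [added [rest [pq ppt sumE pr]]]]]].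
have Fpos p : p \in F -> positive_parts p.
  by case/Fe => e [er _ _] ->; apply: ipart_positive.
have Fsum p : p \in F -> sumn p = n by case/Fe => e eqe ->; apply: sumn_ipart.
have [posq _ refq] := le_q.
have sumq : sumn q = n by rewrite -(Fsum _ Fpj) -(refines_sumn refq).
have sumt := Fsum _ Fpt; have post := Fpos _ Fpt.
move: (posq) (post); rewrite (perm_positive pq) (perm_positive ppt).
rewrite !positive_parts_cat => /andP[posk posr] /andP[posa poss].
have sumka : sumn (kept ++ added) = n.
  by rewrite -sumq (perm_sumn pq) !sumn_cat sumE.
have poska : positive_parts (kept ++ added) by rewrite positive_parts_cat posk.
have le_kr : part_le (kept ++ removed) pj.
  by apply: part_le_trans le_q; apply: part_le_perm; rewrite ?positive_parts_cat ?posk // perm_sym.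
have le_ar : part_le (added ++ rest) pt.
  by apply: part_le_perm; rewrite ?positive_parts_cat ?posa // perm_sym.
suff [p Fp le] : exists2 p, p \in F & part_le (kept ++ added) p.
  by exists p => //; apply: part_le_trans le; apply: part_le_perm; rewrite // (perm_positive pr).
(* With at most one added part, the step merely merges the removed parts of [q], so the result stays
   below [pj]. *)
have [a1|a2] := leqP (size added) 1.
  exists pj => //; apply: part_le_trans le_kr.
  by apply: part_le_small; rewrite // ?positive_parts_cat ?posk.
have sumk : sumn kept = sumn rest.
  have := sumt; rewrite (perm_sumn ppt) -sumka !sumn_cat addnC.
  by move/addIn.
(* Dually, with at most one kept part the result merges the parts [rest] of [pt], as [kept] and
   [rest] have equal sums. *)
have [k1|k2] := leqP (size kept) 1.
  exists pt => //; apply: part_le_trans le_ar.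
  apply: (@part_le_trans _ (added ++ kept)).
    by apply: part_le_perm; rewrite // perm_catC.
  by apply: part_le_small; rewrite // ?positive_parts_cat ?posa ?posk.
apply: (good_two_centers Zext memZ k2 a2 poska sumka).
  exists pj => //; apply: part_le_trans le_kr.
  apply: part_le_small; rewrite ?positive_parts_cat ?posk //= ?addn0 //.
  by rewrite sumn_gt0 // ltnW.
exists pt => //; apply: part_le_trans le_ar.
have posak : positive_parts (added ++ [:: sumn kept]).
  by rewrite positive_parts_cat posa /= sumn_gt0 // ltnW.
apply: (@part_le_trans _ (added ++ [:: sumn kept])).
  have P : perm_eq (sumn kept :: added) (added ++ [:: sumn kept]) by rewrite perm_sym perm_catC.
  by apply: part_le_perm; rewrite // (perm_positive P).
by apply: (part_le_small posak); rewrite ?positive_parts_cat ?posa //= addn0.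
Qed.

Lemma special_extremal n (Z : assignment n) F :
  special_family F ->
  (forall (H : tree_data n) (w : 'I_(nint H)), is_stable_tree H ->
     w \in Z H <-> good F (sep w)) ->
  (forall p, p \in F -> exists2 e : rel 'I_n, eqr e /\ (exists i j, i != j /\ e i j)
     & p = ipart e) ->
  extremal Z.
Proof.
move=> spF memZ Fe.
have Fe' p : p \in F -> exists2 e : rel 'I_n, eqr e & p = ipart e.
  by case/Fe => e [eqe _] ->; exists e.
split=> [H st|H H' pi st st' ctr v'].
  (* If every vertex were assigned, gluing the whole tree would make the intersection of all [sep u]
     good; it is equality, since each leaf is isolated at the vertex that carries it. *)
  apply: contraTneq isT => ZT; have [n0 [symH _] conH _ _] := st.
  pose c := Ordinal n0.
  have conT u : u \in [set: 'I_(nint H)] -> connect (restr [set: 'I_(nint H)]) u c.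
    by move=> _; have := conH u c; apply: connect_sub => x y xy; apply: connect1;
      rewrite /restr !inE.
  have gT u : u \in [set: 'I_(nint H)] -> good F (sep u).
    by move=> _; apply/memZ; rewrite ?ZT ?inE.
  have [p Fp] := good_connected st spF Fe' (in_setT c) conT gT.
  have [e [eqe [i [j [ij eij]]]] ->] := Fe p Fp.
  set E := fun _ _ => _ => le.
  have EE x y : E x y -> x = y.
    move/forall_inP/(_ (att H x) (in_setT _)); rewrite sepE eqxx orbF.
    by move/eqP.
  have eqE : eqr E.
    split=> [x|x y|y x z].
    - by apply/forall_inP => u _; apply: connect0.
    - by apply/idP/idP => h; have := EE _ _ h; move: h => /[swap] ->.
    - by move=> /EE->.
  (* Equality would then contain a permuted copy of [e], which joins two distinct leaves. *)
  have [s sE] := part_le_ipart_perm eqe eqE le.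
  have := sE (s^-1 i)%g (s^-1 j)%g; rewrite !permKV => /(_ eij)/EE/perm_inj E'.
  by rewrite E' eqxx in ij.
have eqs := stable_sep_eqr st; have eqs' := stable_sep_eqr st'.
apply/idP/forall_inP => [/(memZ _ _ st') g w /eqP wv|h].
  apply/memZ => //; apply: good_sub g => // i j; rewrite -wv.
  exact: (sep_contract ctr).
have [surj _ _ _] := ctr; have [c cv] := surj v'.
apply/memZ => //.
have := good_connected (C := [set w | pi w == pi c]) (c := c) st spF Fe'.
rewrite inE eqxx => /(_ isT) H1.
have {H1} g : good F (fun i j => [forall u in [set w | pi w == pi c], sep u i j]).
  apply: H1 => u; rewrite inE => /eqP uc; first exact: (fiber_connected ctr).
  by apply/memZ => //; apply: h; rewrite uc cv.
apply: good_sub g => // [|i j /forall_inP sij]; last first.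
  by apply: (sep_expand ctr st) => w wv; apply: sij; rewrite inE wv cv.
split=> [i|i j|j i k].
- by apply/forall_inP => u _; apply: connect0.
- by apply: eq_forallb_in => u _; have [_ -> _] := eqs u.
- move=> /forall_inP a /forall_inP b; apply/forall_inP => u uS.
  exact: connect_trans (a u uS) (b u uS).
Qed.

Theorem theorem9p6 (n k : nat) (hn : 3 <= n)
  (G : 'I_k -> tree_data n) (v : forall i, 'I_(nint (G i)))
  (hbasic : forall i, is_basic_pair (v i))
  (ZG : 'I_k -> assignment n)
  (hatom : forall i, is_atomic (v i) (ZG i)) :
  let Zp := fun (i : 'I_k) (H : tree_data n) =>
              \bigcup_(s : 'S_n) act_assign s (ZG i) H in
  let Z : assignment n := fun H => \bigcup_(i < k) Zp i H in
  extremal Z <-> special_family [seq int_partition (v i) | i <- enum 'I_k].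
Proof.
move=> Zp Z; set F := map _ _.
have eqv i : eqr (sep (v i)) by apply: stable_sep_eqr; case: (hbasic i).
have Fe p : p \in F -> exists i, p = ipart (sep (v i)).
  by case/mapP => i _ ->; exists i.
have memZ (H : tree_data n) (w : 'I_(nint H)) : is_stable_tree H ->
    w \in Z H <-> good F (sep w).
  move=> st; have eqw := stable_sep_eqr st w; split.
    case/bigcupP => i _ /bigcupP[s _]; rewrite /act_assign.
    have str := relabel_stable s^-1 st.
    move/(@mem_atomic _ _ _ (hbasic i) _ (relabel s^-1 H) w (hatom i) str) => sub.
    exists (int_partition (v i)); first by apply: map_f; rewrite mem_enum.
    (* Relabelling moves the blocks but keeps their sizes. *)
    apply: (@part_le_trans _ (ipart (fun x y => sep w (s x) (s y)))).
      apply: part_le_perm; last by rewrite perm_sym; apply: ipart_perm.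
      by apply: ipart_positive; case: eqw.
    apply: (ipart_sub (eqv i) (eqr_perm s eqw)) => x y /sub.
    by rewrite sep_relabel invgK.
  case=> p /Fe[i ->] le; have [s sub] := part_le_ipart_perm (eqv i) eqw le.
  (* The permutation [s] pulls [sep (v i)] back into [sep w], so the atomic assignment has to be
     translated by its inverse. *)
  apply/bigcupP; exists i => //; apply/bigcupP; exists s^-1%g => //.
  rewrite /act_assign.
  apply/(@mem_atomic _ _ _ (hbasic i) _ (relabel _ H) w (hatom i)).
    exact: relabel_stable.
  by move=> x y sxy; rewrite sep_relabel invgK; apply: sub; rewrite !permKV.
split=> [Zext|spF].
  apply: extremal_special Zext memZ _ => p /Fe[i ->].
  by exists (sep (v i)).
apply: special_extremal spF memZ _ => p /Fe[i ->]; exists (sep (v i)) => //.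
by split=> //; apply: basic_nondiscrete.
Qed.
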